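(* Let $S$ be a finite set of prime numbers. There exist a field $k$ and an algebraic torus $T$ over $k$ such that, for every prime number $p$, the torus $T$ is $p$-retract rational if and only if $p\notin S$.
   Context: For a prime $p$, an (integral) $k$-variety $X$ is called $p$-retract rational if there exist an integer $n$, a $k$-variety $X'$, a finite dominant morphism $f:X'\to X$ of degree not divisible by $p$, a morphism $s:X'\to\mathbb{A}^n_k$ and a rational map $\pi:\mathbb{A}^n_k\dashrightarrow X$ such that the composition $\pi\circ s$ is defined (the image of $s$ meets the domain of definition of $\pi$) and equals $f$ as a rational map. *)

(* Defs.v *)
From HB Require Import structures.
From mathcomp Require Import all_boot all_order all_algebra all_field.
From mathcomp Require Import ring_quotient fraction separable finmap mpoly.

Set Implicit Arguments.
Unset Strict Implicit.
Unset Printing Implicit Defensive.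

Import GRing.Theory.
Local Open Scope ring_scope.

Local Notation "x %:F" := (tofrac x) : ring_scope.

(* All varieties below are affine.  This costs nothing for tori: a torus is
   affine, and a scheme finite over an affine scheme is affine.  An affine
   integral k-variety X is given by its coordinate ring k[X], a k-algebra of
   finite type that is a domain; a morphism Y -> X is a k-algebra morphism
   k[X] -> k[Y].  The computable units carried by comUnitAlgType are,
   classically, no restriction on commutative k-algebras. *)

Definition finite_type (k : fieldType) (A : comUnitAlgType k) : Prop :=
  exists (n : nat) (g : {lrmorphism {mpoly k[n]} -> A}),
    forall a : A, exists q, g q = a.

Record variety (k : fieldType) := Variety {
  variety_alg : comUnitAlgType k;
  variety_domain : GRing.integral_domain_axiom variety_alg;
  variety_ft : finite_type variety_alg
}.

Definition coord (k : fieldType) (X : variety k) : Type := variety_alg X.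

HB.instance Definition _ (k : fieldType) (X : variety k) :=
  GRing.ComUnitAlgebra.on (coord X).
HB.instance Definition _ (k : fieldType) (X : variety k) :=
  GRing.ComUnitRing_isIntegral.Build (coord X) (@variety_domain k X).

Lemma mpoly_finite_type (k : fieldType) (n : nat) :
  finite_type {mpoly k[n]}.
Proof. by exists n, idfun => a; exists a. Qed.

Lemma mpoly_domain (k : fieldType) (n : nat) :
  GRing.integral_domain_axiom {mpoly k[n]}.
Proof. by move=> x y /eqP; rewrite mulf_eq0. Qed.

Definition affine_space (k : fieldType) (n : nat) : variety k :=
  Variety (@mpoly_domain k n) (mpoly_finite_type k n).

Notation morphism Y X := {lrmorphism coord X -> coord Y}.

Section RationalMaps.

Variable k : fieldType.
Implicit Types X Y Z : variety k.

(* A point of X is a prime ideal of its coordinate ring; f sends Q to P when P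
   is the contraction of Q. *)
Definition point X := prime_idealr (coord X).

Definition maps_to Y X (f : morphism Y X) (Q : point Y) (P : point X) : Prop :=
  forall a : coord X, (a \in P) = (f a \in Q).

(* The image of f meets every nonempty basic open subset D(g) of X. *)
Definition dominant Y X (f : morphism Y X) : Prop :=
  forall g : coord X, (exists P : point X, g \notin P) ->
    exists (Q : point Y) (P : point X), maps_to f Q P /\ g \notin P.

Definition finite Y X (f : morphism Y X) : Prop :=
  exists (m : nat) (b : 'I_m -> coord Y),
    forall y : coord Y, exists c : 'I_m -> coord X, y = \sum_i f (c i) * b i.

(* The extension of function fields k(Y) / k(X) induced by f has degree d. *)
Definition has_degree Y X (f : morphism Y X) (d : nat) : Prop :=
  exists phi : {rmorphism {fraction coord X} -> {fraction coord Y}},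
    (forall a : coord X, phi a%:F = (f a)%:F) /\
    exists b : 'I_d -> {fraction coord Y},
      forall y : {fraction coord Y},
        exists! c : {ffun 'I_d -> {fraction coord X}},
          y = \sum_i phi (c i) * b i.

(* A rational map from Y to X is the class of a morphism U -> X, i.e. of a
   k-algebra morphism k[X] -> O(U), with U a nonempty open subset of Y.  Seen
   in the function field of Y it is a k-algebra morphism k[X] -> k(Y);
   conversely, as k[X] is of finite type, any such morphism takes its values
   in some localisation k[Y]_g. *)
Record rational_map Y X := RationalMap {
  comorphism :> {rmorphism coord X -> {fraction coord Y}};
  _ : forall c : k, comorphism c%:A = (c%:A : coord Y)%:F
}.

(* The rational map is represented by a morphism on a basic open
   neighbourhood D(g) of the point P. *)
Definition defined_at Y X (pi : rational_map Y X) (P : point Y) : Prop :=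
  exists2 g : coord Y, g \notin P &
    forall a : coord X, exists (m : nat) (u : coord Y),
      pi a = u%:F / (g ^+ m)%:F.

(* The image of s meets the domain of definition of pi. *)
Definition composable Z Y X (pi : rational_map Y X) (s : morphism Z Y) : Prop :=
  exists (Q : point Z) (P : point Y), maps_to s Q P /\ defined_at pi P.

(* When pi o s is defined, every pi a has the form u / v with s v != 0, and
   the comorphism of pi o s sends a to s u / s v. *)
Definition composite_eq Z Y X (pi : rational_map Y X) (s : morphism Z Y)
    (f : morphism Z X) : Prop :=
  forall (a : coord X) (u v : coord Y),
    s v != 0 -> pi a = u%:F / v%:F -> (s u)%:F / (s v)%:F = (f a)%:F.

Definition p_retract_rational (p : nat) X : Prop :=
  exists (n : nat) (X' : variety k) (f : morphism X' X) (d : nat)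
         (s : morphism X' (affine_space k n))
         (pi : rational_map (affine_space k n) X),
    [/\ finite f, dominant f, has_degree f d & ~~ (p %| d)%N] /\
    (composable pi s /\ composite_eq pi s f).

End RationalMaps.

(* X(R) for a k-algebra R *)
Definition points (k : fieldType) (X : variety k) (R : comUnitAlgType k) :=
  {lrmorphism coord X -> R}.

Definition push (k : fieldType) (X : variety k) (R R' : comUnitAlgType k)
    (h : {lrmorphism R -> R'}) (x : points X R) : points X R' := h \o x.

(* A group structure on a variety, in terms of its functor of points.  Once
   multiplication is natural in R, so are the unit and inversion. *)
Record group_variety (k : fieldType) := GroupVariety {
  group_carrier :> variety k;
  gmul : forall R, points group_carrier R ->
           points group_carrier R -> points group_carrier R;
  gone : forall R, points group_carrier R;
  ginv : forall R, points group_carrier R -> points group_carrier R;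
  gmulA : forall R, associative (@gmul R);
  gmul1 : forall R, left_id (@gone R) (@gmul R);
  gmulV : forall R, left_inverse (@gone R) (@ginv R) (@gmul R);
  gmul_natural : forall (R R' : comUnitAlgType k) (h : {lrmorphism R -> R'})
      (x y : points group_carrier R),
    push h (gmul x y) = gmul (push h x) (push h y)
}.

Definition separable_closure (k L : fieldType) (iota : {rmorphism k -> L}) :
    Prop :=
  (forall x : L, exists q : {poly k},
     separable_poly q /\ root (map_poly iota q) x) /\
  (forall q : {poly L}, separable_poly q -> size q != 1%N ->
     exists x : L, root q x).

(* An L-algebra is the same as a k-algebra R with a ring morphism j : L -> R
   that restricts to the structure map of R on k. *)
Definition extends_scalars (k L : fieldType) (iota : {rmorphism k -> L})
    (R : comUnitAlgType k) (j : {rmorphism L -> R}) : Prop :=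
  forall c : k, j (iota c) = c%:A.

(* An isomorphism of group schemes over L from G_L to the n-th power of the
   multiplicative group, on points: G_L(R) = G(R), and the R-points of the
   target are the n-tuples of units of R. *)
Definition split_over (k : fieldType) (G : group_variety k)
    (L : fieldType) (iota : {rmorphism k -> L}) (n : nat) : Prop :=
  exists chi : forall R : comUnitAlgType k,
      {rmorphism L -> R} -> points G R -> {ffun 'I_n -> R},
  (forall (R : comUnitAlgType k) (j : {rmorphism L -> R}),
      extends_scalars iota j ->
    [/\ forall x i, chi R j x i \is a GRing.unit,
        forall x y i, chi R j (gmul x y) i = chi R j x i * chi R j y i
      & forall u : {ffun 'I_n -> R}, (forall i, u i \is a GRing.unit) ->
          exists! x, chi R j x = u]) /\
  (forall (R R' : comUnitAlgType k) (h : {lrmorphism R -> R'})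
      (j : {rmorphism L -> R}), extends_scalars iota j ->
    forall x i, chi R' (h \o j) (push h x) i = h (chi R j x i)).

(* The separable closure of k being unique up to isomorphism over k, it does
   not matter which one splits the group. *)
Record torus (k : fieldType) := Torus {
  torus_group :> group_variety k;
  torus_split : exists (n : nat) (L : fieldType) (iota : {rmorphism k -> L}),
    separable_closure iota /\ split_over torus_group iota n
}.

(* Main.v *)
From HB Require Import structures.
From mathcomp Require Import all_boot all_order all_algebra all_field.
From mathcomp Require Import ring_quotient fraction separable finmap mpoly.
From mathcomp Require Import generic_quotient boolp.
Require Import Defs.

(* Let n be the product of S, C the field of algebraic numbers, and K = C(s, t)
   with the action of G = (Z/n)^2 by
   s -> z^i s, t -> z^j t, where z is a primitive n-th root of unity, and let
   k = K^G.  The torus T is the group of norm-one elements of K/k.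

   Over K a norm-one element is a product of quotients g(w)/w, so the map
   Q = prod_g R_{K/k}(G_m) -> T, (w_g) |-> prod_g g(w_g)/w_g, from an open subset
   of an affine space is dominant, and the projection T_K -> T, of degree n^2,
   lifts to Q.  Hence T is p-retract rational when p does not divide n.

   Conversely, let X' -> T of degree d factor through an affine space A^m.  The
   generic point u of T, raised to the power d by taking the norm (a determinant)
   from k(X') to k(T), is joined by a line in A^m to the d-th power of a constant
   norm-one element of K.  Along a line the value of a G-invariant multiplicative
   function mu does not change, because two polynomials with the same G-norm have
   conjugate irreducible factors.  Comparing u with w u, where w is a primitive
   np-th root of unity, and taking for mu the n-th power of the leading
   coefficient, gives w^(nd) = 1, so that p divides d. *)

Set Implicit Arguments.
Unset Strict Implicit.
Unset Printing Implicit Defensive.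

Import GRing.Theory.
Local Open Scope ring_scope.

Local Notation "x %:F" := (tofrac x) : ring_scope.

(** The two factors of G leave room for the root of unity w. The norm of a constant is its n^2-th
    power, so a constant of order np has norm one when p divides n, while mu, which takes only an
    n-th power, still sees it. For a cyclic G of order n the constants of norm one are n-th roots of
    unity, which an n-th power kills; there Hilbert 90 makes the norm-one torus rational.

    The torus is described inside the function field of the affine space of the w_g, so an equation
    known at the generic point has to be carried over to every norm-one element of every R (x) K.
    Such an element need not be a product of quotients g(w)/w over R itself. It becomes one over R
    (x) K, which contains R and splits the torus, and the w_g can be chosen there with norms of
    product 1, so that the denominator of the generic point specializes to 1. This one fact yields
    the functor of points of the torus and also the map from the cover to the affine space.

    Algebraic numbers serve as constants because they contain all roots of unity and are countable:
    the separable closure of k is obtained as an algebraic closure of the countable field K. *)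

Section FractionLift.

Variable R : idomainType.

Lemma fracP (x : {fraction R}) :
  {p : R * R | p.2 != 0 & x = p.1%:F / p.2%:F}.
Proof.
have r0 : ((frac (repr x)).2)%:F != 0 by rewrite tofrac_eq0 denom_ratioP.
exists (frac (repr x)); first by apply: (valP (repr x)).
apply: (mulIf r0); rewrite divfK //.
move: r0 (reprK x); move: (repr x) => r _ <-; unlock tofrac.
rewrite -[LHS]FracField.pi_mul; apply/eqmodP => /=.
rewrite FracField.equivfE /= /FracField.mulf.
by rewrite !numden_Ratio ?mulf_neq0 ?denom_ratioP ?oner_neq0 // !mulr1 mulrC.
Qed.

Variables (F : fieldType) (h : R -> F).

(** Multiplicativity and a trivial zero set make the value independent of the representative; this
    covers leading coefficients as well as injective ring morphisms. *)
Definition frac_lift (x : {fraction R}) : F :=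
  h (s2val (fracP x)).1 / h (s2val (fracP x)).2.

Hypothesis hM : {morph h : x y / x * y}.
Hypothesis h_eq0 : forall x, (h x == 0) = (x == 0).

Lemma frac_lift_div a b : b != 0 -> frac_lift (a%:F / b%:F) = h a / h b.
Proof.
move=> b0; rewrite /frac_lift; case: fracP => -[c d] /= d0 e.
apply/eqP; rewrite eqr_div ?h_eq0 // -!hM.
suff -> : c * b = a * d by [].
by apply/eqP; rewrite -tofrac_eq !rmorphM -eqr_div ?tofrac_eq0 // e.
Qed.

Lemma frac_lift_mul : {morph frac_lift : x y / x * y}.
Proof.
move=> x y; case: (fracP x) (fracP y) => -[a b] /= b0 -> [[c d] /= d0 ->].
by rewrite mulf_div -!rmorphM !frac_lift_div ?mulf_neq0 // !hM mulf_div.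
Qed.

Lemma mult_map1 : h 1 = 1.
Proof.
have h10 : h 1 != 0 by rewrite h_eq0 oner_eq0.
by apply: (mulfI h10); rewrite -hM !mulr1.
Qed.

Lemma frac_lift_tofrac a : frac_lift a%:F = h a.
Proof.
by rewrite -[a%:F]divr1 -tofrac1 frac_lift_div ?oner_eq0 // mult_map1 divr1.
Qed.

Lemma frac_lift_eq0 x : (frac_lift x == 0) = (x == 0).
Proof.
case: (fracP x) => -[a b] /= b0 ->; rewrite frac_lift_div // !mulf_eq0 !invr_eq0.
by rewrite !h_eq0 !tofrac_eq0.
Qed.

End FractionLift.

Section FractionMorphism.

Variables (R : idomainType) (F : fieldType) (h : {rmorphism R -> F}).
Hypothesis h_inj : injective h.

Let hM : {morph h : x y / x * y} := @rmorphM _ _ h.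
Let h_eq0 x : (h x == 0) = (x == 0).
Proof. by rewrite -(inj_eq h_inj) rmorph0. Qed.

Fact frac_lift_zmod : zmod_morphism (frac_lift h).
Proof.
move=> x y; case: (fracP x) (fracP y) => -[a b] /= b0 -> [[c d] /= d0 ->].
rewrite -mulNr -rmorphN addf_div ?tofrac_eq0 // -!rmorphM -rmorphD.
rewrite !frac_lift_div ?mulf_neq0 //.
by rewrite rmorphD !rmorphM rmorphN -addf_div ?h_eq0 // mulNr.
Qed.

Fact frac_lift_monoid : monoid_morphism (frac_lift h).
Proof.
split; last exact: frac_lift_mul.
by rewrite -(rmorph1 (@tofrac R)) frac_lift_tofrac // rmorph1.
Qed.

Lemma ex_frac_rmorph : {g : {rmorphism {fraction R} -> F} | forall a, g a%:F = h a}.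
Proof.
pose g := GRing.isZmodMorphism.Build {fraction R} F (frac_lift h) frac_lift_zmod.
pose g' := GRing.isMonoidMorphism.Build {fraction R} F (frac_lift h) frac_lift_monoid.
pose G : {rmorphism {fraction R} -> F} := HB.pack (frac_lift h) g g'.
by exists G => a; rewrite /= frac_lift_tofrac.
Qed.

Definition frac_rmorph : {rmorphism {fraction R} -> F} := sval ex_frac_rmorph.

Lemma frac_rmorphE a : frac_rmorph a%:F = h a.
Proof. by rewrite /frac_rmorph; case: ex_frac_rmorph. Qed.

End FractionMorphism.

Lemma frac_rmorph_ext (R : idomainType) (F : fieldType)
    (g g' : {rmorphism {fraction R} -> F}) :
  (forall a, g a%:F = g' a%:F) -> g =1 g'.
Proof.
by move=> e x; case: (fracP x) => -[a b] /= _ ->; rewrite !fmorph_div !e.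
Qed.

Lemma lrmorph_eq (k : fieldType) (A : comUnitAlgType k) (B : comUnitAlgType k)
    (f g : {lrmorphism A -> B}) : f =1 g -> f = g.
Proof.
case: f => f [[z1] [m1] [s1]]; case: g => g [[z2] [m2] [s2]] /= /funext e.
rewrite e in z1 m1 s1 *; congr GRing.LRMorphism.Pack.
by congr GRing.LRMorphism.Class; congr (_ _); apply: Prop_irrelevance.
Qed.

(** * Kummer extensions *)

(* Structure constants of a Kummer extension of k with basis (e_a), a in kidx:
   e_a e_b = kcoc a b e_(a+b), and its Galois group, identified with kidx, acts by
   g e_a = kch g a e_a. *)
Record kummer (k : fieldType) := Kummer {
  kidx : finZmodType;
  kcoc : kidx -> kidx -> k;
  kch : kidx -> kidx -> k;
  kcocC : forall a b, kcoc a b = kcoc b a;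
  kcoc0 : forall a, kcoc 0 a = 1;
  kcocA : forall a b d,
    kcoc a b * kcoc (a + b) d = kcoc a (b + d) * kcoc b d;
  kcoc_neq0 : forall a b, kcoc a b != 0;
  kchC : forall a b, kch a b = kch b a;
  kch0 : forall a, kch a 0 = 1;
  kchD : forall a b d, kch a (b + d) = kch a b * kch a d;
  kch_nondeg : forall a, a != 0 -> exists b, kch a b != 1;
  kcard_neq0 : #|kidx|%:R != 0 :> k
}.

Section KummerTheory.

Variables (k : fieldType) (D : kummer k).
Implicit Types a b d : kidx D.

Lemma kchDl a b d : kch (a + b) d = kch a d * kch b d.
Proof. by rewrite kchC kchD !(kchC d). Qed.

Lemma kchNr a b : kch a b * kch a (- b) = 1.
Proof. by rewrite -kchD subrr kch0. Qed.

Lemma kch_neq0 a b : kch a b != 0.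
Proof. by apply/eqP => e; have /eqP := kchNr a b; rewrite e mul0r eq_sym oner_eq0. Qed.

Lemma kchNC a b : kch a (- b) = kch b (- a).
Proof.
by apply: (mulfI (kch_neq0 a b)); rewrite kchNr kchC kchNr.
Qed.

(** Orthogonality of characters: multiplying the sum by a value [kch a b] other than 1 only permutes
    its terms. *)
Lemma sum_kch a : \sum_b kch a b = (a == 0)%:R * #|kidx D|%:R.
Proof.
have [->|a0] := eqVneq a 0.
  rewrite mul1r (eq_bigr (fun=> 1)) ?sumr_const // => b _.
  by rewrite kchC kch0.
rewrite mul0r; have [b nb1] := kch_nondeg a0.
have e : kch a b * (\sum_b kch a b) = \sum_b kch a b.
  rewrite mulr_sumr [RHS](reindex_inj (addrI b)) /=.
  by apply: eq_bigr => d _; rewrite kchD.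
apply/eqP; move/eqP: e; rewrite -[X in _ == X]mul1r -subr_eq0 -mulrBl mulf_eq0.
by rewrite subr_eq0 (negbTE nb1).
Qed.

End KummerTheory.

(* The extension of scalars to R, in coordinates with respect to (e_a). *)
Definition tw (k : fieldType) (D : kummer k) (R : comAlgType k) : Type :=
  {ffun kidx D -> R}.

(** * The Kummer algebra over a ring R: group action, norm, splitting *)

Section TwistedAlgebra.

Variables (k : fieldType) (D : kummer k) (R : comAlgType k).

HB.instance Definition _ := GRing.Lmodule.copy (tw D R) {ffun kidx D -> R}.

Implicit Types x y z : tw D R.

Definition tw_mul x y : tw D R :=
  [ffun d => \sum_a kcoc a (d - a) *: (x a * y (d - a))].

Definition tw_inc (r : R) : tw D R := [ffun d => if d == 0 then r else 0].

Fact tw_mulC : commutative tw_mul.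
Proof.
move=> x y; apply/ffunP => d; rewrite !ffunE.
rewrite (reindex_inj (inj_comp (addrI d) oppr_inj)) /=; apply: eq_bigr => a _.
by rewrite opprD opprK addrA subrr add0r kcocC mulrC.
Qed.

Fact tw_mulA : associative tw_mul.
Proof.
move=> x y z; apply/ffunP => d; rewrite !ffunE.
transitivity (\sum_b \sum_a kcoc b (d - b) * kcoc (a - b) (d - a) *:
   (x b * y (a - b) * z (d - a))).
  apply: eq_bigr => b _; rewrite ffunE mulr_sumr scaler_sumr.
  rewrite (reindex_inj (addIr (- b))) /=; apply: eq_bigr => a _.
  rewrite -scalerAr scalerA mulrA opprB.
  by rewrite (_ : d - b + (b - a) = d - a) // addrA subrK.
rewrite exchange_big; apply: eq_bigr => a _ /=.
rewrite ffunE mulr_suml scaler_sumr; apply: eq_bigr => b _.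
rewrite -scalerAl scalerA; congr (_ *: _).
have := @kcocA _ D b (a - b) (d - a).
rewrite [b + (a - b)]addrC subrK (_ : a - b + (d - a) = d - b); last first.
  by rewrite addrC addrA subrK.
by move=> <-; rewrite mulrC.
Qed.

Lemma tw_mulE_inc r x : tw_mul (tw_inc r) x = [ffun d => r * x d].
Proof.
apply/ffunP => d; rewrite !ffunE (bigD1 0) //= big1 ?addr0 => [|a /negbTE a0].
  by rewrite ffunE eqxx subr0 kcoc0 scale1r.
by rewrite ffunE a0 mul0r scaler0.
Qed.

Fact tw_mul1 : left_id (tw_inc 1) tw_mul.
Proof. by move=> x; rewrite tw_mulE_inc; apply/ffunP => d; rewrite ffunE mul1r. Qed.

Fact tw_mulDl : left_distributive tw_mul +%R.
Proof.
move=> x y z; apply/ffunP => d; rewrite !ffunE -big_split; apply: eq_bigr => a _.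
by rewrite ffunE mulrDl scalerDr.
Qed.

Fact tw_one_neq0 : tw_inc 1 != 0 :> tw D R.
Proof.
by apply/eqP => /ffunP/(_ 0); rewrite !ffunE eqxx => /eqP; rewrite oner_eq0.
Qed.

HB.instance Definition _ := GRing.Zmodule_isComNzRing.Build (tw D R)
  tw_mulA tw_mulC tw_mul1 tw_mulDl tw_one_neq0.

Fact tw_scalerAl (c : k) x y : c *: (x * y) = (c *: x) * y.
Proof.
apply/ffunP => d; rewrite !ffunE scaler_sumr; apply: eq_bigr => a _.
by rewrite ffunE -scalerAl !scalerA mulrC.
Qed.

HB.instance Definition _ := GRing.Lmodule_isLalgebra.Build k (tw D R) tw_scalerAl.
HB.instance Definition _ := GRing.Lalgebra_isComAlgebra.Build k (tw D R).

Lemma tw_mulE x y d :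
  (x * y) d = \sum_a kcoc a (d - a) *: (x a * y (d - a)).
Proof. by rewrite ffunE. Qed.

Fact tw_inc_is_zmod_morphism : zmod_morphism tw_inc.
Proof.
move=> r s; apply/ffunP => d; rewrite !ffunE.
by case: ifP; rewrite ?subr0.
Qed.

Fact tw_inc_is_monoid_morphism : monoid_morphism tw_inc.
Proof.
split=> // r s; rewrite [RHS]tw_mulE_inc; apply/ffunP => d; rewrite !ffunE.
by case: ifP; rewrite ?mulr0.
Qed.

Fact tw_inc_is_scalable : scalable tw_inc.
Proof.
move=> c r; apply/ffunP => d; rewrite !ffunE.
by case: ifP; rewrite ?scaler0.
Qed.

HB.instance Definition _ :=
  GRing.isZmodMorphism.Build R (tw D R) tw_inc tw_inc_is_zmod_morphism.
HB.instance Definition _ :=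
  GRing.isMonoidMorphism.Build R (tw D R) tw_inc tw_inc_is_monoid_morphism.
HB.instance Definition _ :=
  GRing.isScalable.Build k R (tw D R) *:%R tw_inc tw_inc_is_scalable.

Lemma tw_incM r x d : (tw_inc r * x) d = r * x d.
Proof. by rewrite [tw_inc r * x]tw_mulE_inc ffunE. Qed.

Lemma tw_inc_inj : injective tw_inc.
Proof. by move=> r s /ffunP/(_ 0); rewrite !ffunE eqxx. Qed.

Definition tw_delta (a : kidx D) : tw D R := [ffun d => if d == a then 1 else 0].

Lemma tw_deltaM a b : tw_delta a * tw_delta b = kcoc a b *: tw_delta (a + b).
Proof.
apply/ffunP => d; rewrite tw_mulE (bigD1 a) //= big1 => [|e /negbTE ea].
  rewrite !ffunE eqxx mul1r addr0 subr_eq (addrC b).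
  by have [->|_] := eqVneq d; rewrite ?scaler0 // addrC addKr.
by rewrite ffunE ea mul0r scaler0.
Qed.

Lemma tw_sum_delta x : x = \sum_a tw_inc (x a) * tw_delta a.
Proof.
apply/ffunP => d; rewrite sum_ffunE (bigD1 d) //= big1 => [|e ed].
  by rewrite tw_incM ffunE eqxx mulr1 addr0.
by rewrite tw_incM ffunE eq_sym (negbTE ed) mulr0.
Qed.

Definition tw_act (g : kidx D) x : tw D R := [ffun a => kch g a *: x a].

Fact tw_act_is_zmod_morphism g : zmod_morphism (tw_act g).
Proof. by move=> x y; apply/ffunP => d; rewrite !ffunE scalerBr. Qed.

Fact tw_act_is_monoid_morphism g : monoid_morphism (tw_act g).
Proof.
split=> [|x y]; apply/ffunP => d.
  by rewrite !ffunE; case: eqP => [->|_]; rewrite ?scaler0 // kch0 scale1r.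
rewrite ffunE !tw_mulE scaler_sumr; apply: eq_bigr => a _; rewrite !ffunE.
rewrite -scalerAl -scalerAr !scalerA; congr (_ *: _).
by rewrite -mulrA -kchD [a + _]addrC subrK mulrC.
Qed.

HB.instance Definition _ g :=
  GRing.isZmodMorphism.Build (tw D R) (tw D R) (tw_act g) (tw_act_is_zmod_morphism g).
HB.instance Definition _ g :=
  GRing.isMonoidMorphism.Build (tw D R) (tw D R) (tw_act g) (tw_act_is_monoid_morphism g).

Lemma tw_actD g h x : tw_act (g + h) x = tw_act g (tw_act h x).
Proof. by apply/ffunP => d; rewrite !ffunE kchDl scalerA. Qed.

Lemma tw_act0 x : tw_act 0 x = x.
Proof. by apply/ffunP => d; rewrite !ffunE kchC kch0 scale1r. Qed.

Lemma tw_act_inc g r : tw_act g (tw_inc r) = tw_inc r.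
Proof.
by apply/ffunP => d; rewrite !ffunE; case: eqP => [->|]; rewrite ?scaler0 ?kch0 ?scale1r.
Qed.

(** Some g multiplies the coordinate at [d != 0] by a scalar other than 1, so an invariant element
    has only its coordinate at 0. *)
Lemma tw_fixed x : (forall g, tw_act g x = x) -> x = tw_inc (x 0).
Proof.
move=> fx; apply/ffunP => d; rewrite ffunE; have [->//|d0] := eqVneq d 0.
have [g] := kch_nondeg d0; rewrite kchC => g1.
have /ffunP/(_ d)/eqP := fx g; rewrite ffunE -subr_eq0 -[X in _ - X]scale1r.
rewrite -scalerBl => /eqP e.
apply: (can_inj (scalerK (_ : kch g d - 1 != 0))); last by rewrite scaler0.
by rewrite subr_eq0.
Qed.

(** The product of the conjugates is invariant, hence carried by its coordinate at 0. *)
Definition tw_norm x : R := (\prod_g tw_act g x) 0.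

Lemma tw_normE x : tw_inc (tw_norm x) = \prod_g tw_act g x.
Proof.
rewrite -tw_fixed // => h; rewrite rmorph_prod [RHS](reindex_inj (addrI h)) /=.
by apply: eq_bigr => g _; rewrite tw_actD.
Qed.

Lemma tw_normM x y : tw_norm (x * y) = tw_norm x * tw_norm y.
Proof.
apply: tw_inc_inj; rewrite tw_normE rmorphM /= !tw_normE -big_split /=.
by apply: eq_bigr => g _; rewrite rmorphM.
Qed.

Lemma tw_norm_act g x : tw_norm (tw_act g x) = tw_norm x.
Proof.
apply: tw_inc_inj; rewrite !tw_normE [RHS](reindex_inj (addIr g)) /=.
by apply: eq_bigr => h _; rewrite tw_actD.
Qed.

Lemma tw_norm_inc r : tw_norm (tw_inc r) = r ^+ #|kidx D|.
Proof.
apply: tw_inc_inj; rewrite tw_normE rmorphXn /= -prodr_const.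
by apply: eq_bigr => g _; rewrite tw_act_inc.
Qed.

Lemma tw_norm1 : tw_norm 1 = 1.
Proof. by rewrite -[1]/(tw_inc 1) tw_norm_inc expr1n. Qed.

(** A substitute for the inverse over any R, as an adjugate is for a matrix; it is the inverse when
    the norm is 1. *)
Definition tw_cof x : tw D R := \prod_(g | g != 0) tw_act g x.

Lemma tw_mul_cof x : x * tw_cof x = tw_inc (tw_norm x).
Proof. by rewrite tw_normE (bigD1 0) //= tw_act0. Qed.

Lemma tw_norm_cof x : tw_norm (tw_cof x) * tw_norm x = tw_norm x ^+ #|kidx D|.
Proof. by rewrite mulrC -tw_normM tw_mul_cof tw_norm_inc. Qed.

End TwistedAlgebra.

Arguments tw_inc {k} D {R} r.
Arguments tw_delta {k D} R a.

Section TwistedMap.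

Variables (k : fieldType) (D : kummer k) (R R' : comAlgType k).
Variable h : {lrmorphism R -> R'}.
Implicit Types x y : tw D R.

Definition tw_map x : tw D R' := [ffun a => h (x a)].

Fact tw_map_is_zmod_morphism : zmod_morphism tw_map.
Proof. by move=> x y; apply/ffunP => a; rewrite !ffunE rmorphB. Qed.

Fact tw_map_is_monoid_morphism : monoid_morphism tw_map.
Proof.
split=> [|x y]; apply/ffunP => d.
  by rewrite !ffunE; case: ifP; rewrite ?rmorph1 ?rmorph0.
rewrite tw_mulE !ffunE raddf_sum; apply: eq_bigr => a _ /=.
by rewrite linearZ /= rmorphM !ffunE.
Qed.

HB.instance Definition _ :=
  GRing.isZmodMorphism.Build (tw D R) (tw D R') tw_map tw_map_is_zmod_morphism.
HB.instance Definition _ :=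
  GRing.isMonoidMorphism.Build (tw D R) (tw D R') tw_map tw_map_is_monoid_morphism.

Lemma tw_map_inc r : tw_map (tw_inc D r) = tw_inc D (h r).
Proof. by apply/ffunP => a; rewrite !ffunE; case: ifP; rewrite ?rmorph0. Qed.

Lemma tw_map_act g x : tw_map (tw_act g x) = tw_act g (tw_map x).
Proof. by apply/ffunP => a; rewrite !ffunE linearZ. Qed.

Lemma tw_map_cof x : tw_map (tw_cof x) = tw_cof (tw_map x).
Proof. by rewrite /tw_cof rmorph_prod; apply: eq_bigr => g _; rewrite -tw_map_act. Qed.

Lemma tw_map_norm x : h (tw_norm x) = tw_norm (tw_map x).
Proof.
apply: (@tw_inc_inj _ D); rewrite -tw_map_inc !tw_normE rmorph_prod /=.
by apply: eq_bigr => g _; rewrite -tw_map_act.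
Qed.

End TwistedMap.

Section Evaluation.

Variables (k : fieldType) (D : kummer k) (R : comAlgType k) (S : nzRingType).
Variables (h : {rmorphism R -> S}) (e : kidx D -> S).

Hypothesis e0 : e 0 = 1.
Hypothesis eM : forall a b, e a * e b = h (kcoc a b)%:A * e (a + b).
Hypothesis eC : forall a r, e a * h r = h r * e a.

(** Besides fields, S will be a ring of matrices over polynomials, whence the commutation hypothesis
    [eC]. *)
Definition tw_ev (x : tw D R) : S := \sum_a h (x a) * e a.

Fact tw_ev_is_zmod_morphism : zmod_morphism tw_ev.
Proof.
move=> x y; rewrite /tw_ev -sumrB; apply: eq_bigr => a _.
by rewrite !ffunE rmorphB mulrBl.
Qed.

Lemma tw_ev_inc r : tw_ev (tw_inc D r) = h r.
Proof.
rewrite /tw_ev (bigD1 0) //= big1 => [|a /negbTE a0].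
  by rewrite ffunE eqxx e0 mulr1 addr0.
by rewrite ffunE a0 rmorph0 mul0r.
Qed.

Fact tw_ev_is_monoid_morphism : monoid_morphism tw_ev.
Proof.
split=> [|x y]; first by rewrite -[1 in LHS]/(tw_inc D 1) tw_ev_inc rmorph1.
rewrite /tw_ev mulr_suml.
transitivity (\sum_a \sum_d h (kcoc a (d - a) *: (x a * y (d - a))) * e d).
  by rewrite exchange_big; apply: eq_bigr => d _; rewrite tw_mulE raddf_sum mulr_suml.
apply: eq_bigr => a _; rewrite mulr_sumr (reindex_inj (addIr a)) /=.
apply: eq_bigr => b _; rewrite addrK -mulr_algl !rmorphM /= -[RHS]mulrA.
rewrite (mulrA (e a)) eC -!mulrA eM addrC !mulrA; congr (_ * _).
by rewrite -!rmorphM; congr (h _); rewrite [RHS]mulrC mulrA.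
Qed.

End Evaluation.

Section Characters.

Variables (k : fieldType) (D : kummer k) (R : comAlgType k).
Implicit Types (x y : tw D R) (g a : kidx D).

(* A copy in R of the standard basis of the Kummer extension. *)
Definition frame (e : kidx D -> R) : Prop :=
  e 0 = 1 /\ forall a b, e a * e b = kcoc a b *: e (a + b).

Variable e : kidx D -> R.

(** Over a frame the algebra is a product of copies of R indexed by the group, and [chi g] is a
    projection. *)
Definition chi g x : R := \sum_a x a * (kch g a *: e a).

(** Fourier inversion; [e (- a)] divided by [kcoc a (- a)] is the inverse of [e a]. *)
Definition ichi (X : kidx D -> R) : tw D R :=
  [ffun a => (#|kidx D|%:R^-1 / kcoc a (- a)) *:
             (e (- a) * \sum_g kch g (- a) *: X g)].

Hypothesis fe : frame e.

Fact chi_is_monoid_morphism g : monoid_morphism (chi g).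
Proof.
case: fe => e0 eM.
apply: (@tw_ev_is_monoid_morphism _ D R R idfun) => [|a b|a r] /=.
- by rewrite kch0 scale1r.
- rewrite -scalerAl -scalerAr eM !scalerA mulr_algl scalerA kchD.
  by congr (_ *: _); rewrite mulrC.
- exact: mulrC.
Qed.

Lemma chiM g x y : chi g (x * y) = chi g x * chi g y.
Proof. by rewrite (chi_is_monoid_morphism g).2. Qed.

Lemma chi1 g : chi g 1 = 1.
Proof. by rewrite (chi_is_monoid_morphism g).1. Qed.

Lemma chi_prod (I : Type) (r : seq I) (P : pred I) (F : I -> tw D R) g :
  chi g (\prod_(i <- r | P i) F i) = \prod_(i <- r | P i) chi g (F i).
Proof. by apply: (big_morph (chi g)) => [x y|]; rewrite ?chiM ?chi1. Qed.

Lemma chi_inc g r : chi g (tw_inc D r) = r.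
Proof.
by apply: (@tw_ev_inc _ D R R idfun); rewrite kch0 scale1r fe.1.
Qed.

Lemma chi_act g h x : chi h (tw_act g x) = chi (h + g) x.
Proof.
apply: eq_bigr => a _; rewrite ffunE kchDl -scalerAl -scalerAr scalerA scalerAr.
by rewrite [kch g a * _]mulrC.
Qed.

Lemma frame_inv a : e a * e (- a) = (kcoc a (- a))%:A.
Proof. by rewrite fe.2 subrr fe.1. Qed.

Lemma ichiK X g : chi g (ichi X) = X g.
Proof.
transitivity (\sum_a #|kidx D|%:R^-1 *: \sum_h kch a (g - h) *: X h).
  apply: eq_bigr => a _; rewrite ffunE -scalerAl -scalerAr scalerA.
  rewrite [e (- a) * _ * _]mulrAC [e (- a) * _]mulrC frame_inv mulr_algl scalerA.
  rewrite (_ : _ / _ * _ * _ = #|kidx D|%:R^-1 * kch g a); last first.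
    by rewrite mulrAC divfK ?kcoc_neq0.
  rewrite -scalerA; congr (_ *: _).
  rewrite scaler_sumr; apply: eq_bigr => h _; rewrite scalerA; congr (_ *: _).
  by rewrite kchD (kchC g) kchNC.
rewrite -scaler_sumr exchange_big /= (bigD1 g) //= [X in _ + X]big1 => [|h hg].
  rewrite addr0 -scaler_suml (eq_bigr (fun a => kch 0 a)); last first.
    by move=> a _; rewrite subrr kchC.
  by rewrite sum_kch eqxx mul1r scalerA mulVf ?kcard_neq0 // scale1r.
rewrite -scaler_suml (eq_bigr (fun a => kch (g - h) a)); last first.
  by move=> a _; rewrite kchC.
by rewrite sum_kch subr_eq0 eq_sym (negbTE hg) mul0r scale0r.
Qed.

Lemma chiK x : ichi (fun g => chi g x) = x.
Proof.
apply/ffunP => a; rewrite ffunE.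
have -> : \sum_g kch g (- a) *: chi g x = #|kidx D|%:R *: (x a * e a).
  transitivity (\sum_g \sum_b kch (b - a) g *: (x b * e b)).
    apply: eq_bigr => g _; rewrite scaler_sumr; apply: eq_bigr => b _.
    by rewrite -scalerAr scalerA -kchD kchC [- a + b]addrC.
  rewrite exchange_big /= (bigD1 a) //= [X in _ + X]big1 => [|b /negbTE ba].
    by rewrite -scaler_suml sum_kch subrr eqxx mul1r addr0.
  by rewrite -scaler_suml sum_kch subr_eq0 ba mul0r scale0r.
rewrite -scalerAr scalerA mulrCA [e (- a) * _]mulrC frame_inv -scalerAr scalerA.
by rewrite mulr1 mulrAC divfK ?kcoc_neq0 // mulVf ?kcard_neq0 // scale1r.
Qed.

Lemma chi_inj x y : (forall g, chi g x = chi g y) -> x = y.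
Proof. by move=> /funext exy; rewrite -[x]chiK exy chiK. Qed.

Lemma norm_chi x : tw_norm x = \prod_g chi g x.
Proof.
rewrite -(chi_inc 0 (tw_norm x)) tw_normE chi_prod.
by apply: eq_bigr => g _; rewrite chi_act add0r.
Qed.

End Characters.

(** The Kummer algebra splits itself: any R acquires a frame after the injective extension to
    [tw D R]. *)
Lemma tw_delta_frame (k : fieldType) (D : kummer k) (R : comAlgType k) :
  frame (tw_delta R : kidx D -> tw D R).
Proof. by split=> // a b; rewrite tw_deltaM. Qed.

(** * Evaluation of polynomials, and rational functions as a k-algebra *)

Lemma mpoly_eval_subproof (k : fieldType) (n : nat) (R : comAlgType k)
    (v : 'I_n -> R) :
  {f : {lrmorphism {mpoly k[n]} -> R} | forall p, f p = mmap (in_alg R) v p}.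
Proof.
pose f := mmap (in_alg R) v; pose f' : {rmorphism {mpoly k[n]} -> R} := f.
have fZ : scalable f by move=> c p; rewrite /f mmapZ /= mulr_algl.
pose s := GRing.isScalable.Build k {mpoly k[n]} R *:%R f fZ.
pose F : {lrmorphism {mpoly k[n]} -> R} := HB.pack f s
  (GRing.isZmodMorphism.Build _ _ f (raddfB f))
  (GRing.isMonoidMorphism.Build _ _ f (rmorph1 f', rmorphM f')).
by exists F.
Qed.

Definition mpoly_eval (k : fieldType) (n : nat) (R : comAlgType k)
  (v : 'I_n -> R) : {lrmorphism {mpoly k[n]} -> R} := sval (mpoly_eval_subproof v).

Lemma mpoly_evalX (k : fieldType) (n : nat) (R : comAlgType k)
  (v : 'I_n -> R) i : mpoly_eval v 'X_i = v i.
Proof.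
by rewrite /mpoly_eval; case: mpoly_eval_subproof => f /= ->; rewrite mmapX mmap1U.
Qed.

Lemma mpoly_ringind (k : fieldType) (n : nat) (P : {mpoly k[n]} -> Prop) :
    (forall c, P c%:MP) -> (forall i, P 'X_i) ->
    (forall p q, P p -> P q -> P (p + q)) ->
    (forall p q, P p -> P q -> P (p * q)) ->
  forall p, P p.
Proof.
move=> PC PX PD PM; elim/mpolyind => [|c m p _ _ Pp]; first by rewrite -mpolyC0.
apply: (PD) => //; rewrite -mul_mpolyC; apply: (PM) => //; rewrite mpolyXE_id.
elim/big_ind: _ => [|p1 p2 P1 P2|i _]; [by rewrite -mpolyC1|exact: PM|].
by elim: (m i) => [|j IH]; [rewrite expr0 -mpolyC1|rewrite exprS; apply: PM].
Qed.

Lemma mpoly_lrmorph_ext (k : fieldType) (n : nat) (R : algType k)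
    (f g : {lrmorphism {mpoly k[n]} -> R}) :
  (forall i, f 'X_i = g 'X_i) -> f =1 g.
Proof.
move=> e; elim/mpoly_ringind => [c|//|p q ep eq|p q ep eq].
- by rewrite -alg_mpolyC !rmorph_alg.
- by rewrite !rmorphD /= ep eq.
- by rewrite !rmorphM /= ep eq.
Qed.

Lemma mpoly_eval_comp (k : fieldType) (n : nat) (R R' : comAlgType k)
    (h : {lrmorphism R -> R'}) (v : 'I_n -> R) p :
  h (mpoly_eval v p) = mpoly_eval (fun i => h (v i)) p.
Proof.
by apply: (@mpoly_lrmorph_ext _ _ _ (h \o mpoly_eval v)) => i /=; rewrite !mpoly_evalX.
Qed.

(* The fraction field depends on the proof that the ring is a domain: it has to
   be the one chosen in [affine_space]. *)
Definition ratfun (k : fieldType) (n : nat) : Type :=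
  {fraction coord (affine_space k n)}.

Section RationalFunctions.

Variables (k : fieldType) (n : nat).

HB.instance Definition _ := GRing.Field.copy (ratfun k n)
  {fraction coord (affine_space k n)}.

Definition ratfun_scale (c : k) (x : ratfun k n) : ratfun k n :=
  (c%:MP : coord (affine_space k n))%:F * x.

Fact ratfun_scalerA a b x : ratfun_scale a (ratfun_scale b x) = ratfun_scale (a * b) x.
Proof. by rewrite /ratfun_scale mulrA -!rmorphM. Qed.

Fact ratfun_scale1 : left_id 1 ratfun_scale.
Proof. by move=> x; rewrite /ratfun_scale mpolyC1 rmorph1 mul1r. Qed.

Fact ratfun_scalerDr : right_distributive ratfun_scale +%R.
Proof. by move=> a x y; rewrite /ratfun_scale mulrDr. Qed.

Fact ratfun_scalerDl x : {morph ratfun_scale^~ x : a b / a + b}.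
Proof. by move=> a b; rewrite /ratfun_scale !rmorphD mulrDl. Qed.

HB.instance Definition _ := GRing.Zmodule_isLmodule.Build k (ratfun k n)
  ratfun_scalerA ratfun_scale1 ratfun_scalerDr ratfun_scalerDl.

Fact ratfun_scalerAl (c : k) (x y : ratfun k n) : c *: (x * y) = (c *: x) * y.
Proof. exact: mulrA. Qed.

HB.instance Definition _ :=
  GRing.Lmodule_isLalgebra.Build k (ratfun k n) ratfun_scalerAl.
HB.instance Definition _ := GRing.Lalgebra_isComAlgebra.Build k (ratfun k n).

Definition torat (p : {mpoly k[n]}) : ratfun k n :=
  (p : coord (affine_space k n))%:F.

Fact torat_is_scalable : scalable torat.
Proof. by move=> c p; rewrite /torat -mul_mpolyC rmorphM. Qed.

HB.instance Definition _ :=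
  GRing.RMorphism.copy torat (@tofrac (coord (affine_space k n))).
HB.instance Definition _ :=
  GRing.isScalable.Build k {mpoly k[n]} (ratfun k n) *:%R torat torat_is_scalable.

Lemma torat_eq0 p : (torat p == 0) = (p == 0).
Proof. exact: tofrac_eq0. Qed.

Lemma torat_inj : injective torat.
Proof. by move=> p q /eqP; rewrite tofrac_eq => /eqP. Qed.

End RationalFunctions.

(** * The norm-one torus *)

Section GenericPoint.

Variables (k : fieldType) (D : kummer k).

Definition gdim := #|{: kidx D * kidx D}|.

Definition gfun := ratfun k gdim.

Definition gen (g : kidx D) : tw D {mpoly k[gdim]} :=
  [ffun a => 'X_(enum_rank (g, a))].

(* The generic point is the product of the quotients g(W_g) / W_g; the inverse of
   W_g is its cofactor divided by its norm. *)
Definition gnum : tw D {mpoly k[gdim]} := \prod_g (tw_act g (gen g) * tw_cof (gen g)).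

Definition gden : {mpoly k[gdim]} := \prod_g tw_norm (gen g).

Definition gpt : tw D gfun := tw_inc D (torat gden)^-1 * tw_map (@torat k gdim) gnum.

Definition spec (R : comAlgType k) (w : kidx D -> tw D R) :
    {lrmorphism {mpoly k[gdim]} -> R} :=
  mpoly_eval (fun i => w (enum_val i).1 (enum_val i).2).

Lemma spec_gen (R : comAlgType k) (w : kidx D -> tw D R) g :
  tw_map (spec w) (gen g) = w g.
Proof. by apply/ffunP => a; rewrite !ffunE mpoly_evalX enum_rankK. Qed.

Lemma spec_gnum (R : comAlgType k) (w : kidx D -> tw D R) :
  tw_map (spec w) gnum = \prod_g (tw_act g (w g) * tw_cof (w g)).
Proof.
rewrite rmorph_prod; apply: eq_bigr => g _.
by rewrite rmorphM /= tw_map_act tw_map_cof spec_gen.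
Qed.

Lemma spec_gden (R : comAlgType k) (w : kidx D -> tw D R) :
  spec w gden = \prod_g tw_norm (w g).
Proof.
by rewrite rmorph_prod; apply: eq_bigr => g _; rewrite /= tw_map_norm spec_gen.
Qed.

Lemma gden_neq0 : gden != 0.
Proof.
apply/eqP => e; have := spec_gden (fun=> 1 : tw D k^o).
rewrite e rmorph0 big1 => [/eqP|g _]; last by rewrite tw_norm1.
by rewrite eq_sym oner_eq0.
Qed.

Lemma tw_norm_gnum : tw_norm gnum = gden ^+ #|kidx D|.
Proof.
rewrite /gnum /gden (big_morph (@tw_norm _ D _) (@tw_normM _ D _) (@tw_norm1 _ D _)).
rewrite -prodrXl; apply: eq_bigr => g _.
by rewrite tw_normM tw_norm_act mulrC tw_norm_cof.
Qed.

Lemma tw_norm_gpt : tw_norm gpt = 1.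
Proof.
rewrite /gpt tw_normM tw_norm_inc -tw_map_norm tw_norm_gnum rmorphXn /=.
by rewrite -exprMn mulVf ?expr1n // torat_eq0 gden_neq0.
Qed.

Lemma gptE a : gpt a = torat (gnum a) / torat gden.
Proof. by rewrite tw_incM ffunE mulrC. Qed.

Definition poly_at (R : comAlgType k) (x : tw D R) :
    {lrmorphism {mpoly k[#|kidx D|]} -> R} :=
  mpoly_eval (fun i => x (enum_val i)).

Lemma poly_at_map (R R' : comAlgType k) (h : {lrmorphism R -> R'}) (x : tw D R) P :
  h (poly_at x P) = poly_at (tw_map h x) P.
Proof.
rewrite /poly_at mpoly_eval_comp; congr (mpoly_eval _ _).
by apply/funext => i; rewrite ffunE.
Qed.

Lemma poly_atX (R : comAlgType k) (x : tw D R) i : poly_at x 'X_i = x (enum_val i).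
Proof. exact: mpoly_evalX. Qed.

Lemma poly_at_rank (R : comAlgType k) (x : tw D R) a :
  poly_at x 'X_(enum_rank a) = x a.
Proof. by rewrite mpoly_evalX enum_rankK. Qed.

(* Over a frame a norm-one element is a product of quotients g(w)/w: it is the
   specialization of the generic point at elements w whose norms multiply to 1. *)
Lemma norm1_spec (R : comAlgType k) (e : kidx D -> R) (x : tw D R) :
    frame e -> tw_norm x = 1 ->
  exists2 w, spec w gden = 1 & tw_map (spec w) gnum = x.
Proof.
move=> fe; rewrite (norm_chi fe) => x1.
pose X g := chi e g x.
have XN : \prod_g X (- g) = 1 by rewrite -[RHS]x1 [RHS](reindex_inj oppr_inj).
(* For g != 0 the quotient g(w g)/w g is [X (- g)] at place [- g], its inverse at place 0, and 1
   elsewhere. At place 0 the inverses gather to [X 0], because the values of X multiply to 1. *)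
pose w g := ichi e (fun h => if h == 0 then X (- g) else 1).
have chiw g h : chi e h (w g) = if h == 0 then X (- g) else 1.
  by rewrite ichiK.
have chicof g h : chi e h (tw_cof (w g)) = if h == 0 then 1 else X (- g).
  rewrite chi_prod //; have [->|h0] := eqVneq h 0.
    by apply: big1 => i /negbTE i0; rewrite chi_act chiw add0r i0.
  rewrite (bigD1 (- h)) ?oppr_eq0 //= chi_act chiw subrr eqxx.
  rewrite big1 ?mulr1 // => i /andP[_ ih].
  by rewrite chi_act chiw addrC addr_eq0 (negbTE ih).
exists w.
  rewrite spec_gden -[RHS]XN; apply: eq_bigr => g _; rewrite (norm_chi fe).
  rewrite (bigD1 0) //= chiw eqxx big1 ?mulr1 // => i /negbTE i0.
  by rewrite chiw i0.
apply: (chi_inj fe) => h; rewrite spec_gnum chi_prod // -/(X h).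
transitivity (\prod_g ((if g == - h then X h else 1) *
                       (if h == 0 then 1 else X (- g)))).
  apply: eq_bigr => g _; rewrite chiM // chi_act chiw chicof addrC addr_eq0.
  by case: eqP => // ->; rewrite opprK.
rewrite big_split /= (bigD1 (- h)) //= eqxx big1 ?mulr1 => [|i /negbTE -> //].
have [_|_] := eqVneq h 0; first by rewrite big1 ?mulr1.
by rewrite XN mulr1.
Qed.

(** Denominators are powers of [gden]. Wherever [gden] specializes to 1 the numerator Q already
    gives the value of P, so that specialization makes sense in any R. *)
Lemma gpt_poly_at (P : {mpoly k[#|kidx D|]}) :
  exists (M : nat) (Q : {mpoly k[gdim]}),
    poly_at gpt P * torat gden ^+ M = torat Q /\
    forall (R : comAlgType k) (w : kidx D -> tw D R), spec w gden = 1 ->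
      spec w Q = poly_at (tw_map (spec w) gnum) P.
Proof.
have d0 : torat gden != 0 by rewrite torat_eq0 gden_neq0.
elim/mpoly_ringind: P => [c|i|p q|p q].
- exists 0, c%:MP; split=> [|R w _]; rewrite -!alg_mpolyC !rmorph_alg //.
  by rewrite mulr1.
- exists 1, (gnum (enum_val i)); split=> [|R w w1].
    by rewrite mpoly_evalX gptE divfK.
  by rewrite mpoly_evalX ffunE.
- move=> [M [Q [e1 e2]]] [M' [Q' [e1' e2']]].
  exists (M + M')%N, (Q * gden ^+ M' + Q' * gden ^+ M); split=> [|R w w1].
    rewrite rmorphD exprD mulrDl mulrA e1 [_ ^+ M * _]mulrC mulrA e1'.
    by rewrite rmorphD !rmorphM !rmorphXn.
  by rewrite !rmorphD !rmorphM !rmorphXn /= w1 !expr1n !mulr1 e2 // e2'.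
- move=> [M [Q [e1 e2]]] [M' [Q' [e1' e2']]].
  exists (M + M')%N, (Q * Q'); split=> [|R w w1].
    by rewrite !rmorphM exprD mulrACA e1 e1'.
  by rewrite !rmorphM /= e2 // e2'.
Qed.

(** Over [tw D R], which contains R and has a frame, x is a specialization of the generic point. *)
Lemma gpt_generic (P : {mpoly k[#|kidx D|]}) (R : comAlgType k) (x : tw D R) :
  poly_at gpt P = 0 -> tw_norm x = 1 -> poly_at x P = 0.
Proof.
move=> P0 x1; have [M [Q [e eQ]]] := gpt_poly_at P.
move: e; rewrite P0 mul0r => /esym/eqP; rewrite torat_eq0 => /eqP Q0.
apply: (@tw_inc_inj _ D); rewrite rmorph0 poly_at_map.
have xx1 : tw_norm (tw_map (@tw_inc _ D R) x) = 1.
  by rewrite -tw_map_norm x1 rmorph1.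
have [w w1 <-] := norm1_spec (tw_delta_frame D R) xx1.
by rewrite -eQ // Q0 rmorph0.
Qed.

End GenericPoint.

(** * The coordinate ring of the torus and its functor of points *)

Section ClassicalUnits.

Variable R : comNzRingType.

Definition classical_unit : {pred R} := fun x => `[< exists y, y * x = 1 >].

Definition classical_inv (x : R) : R :=
  if pselect (exists y, y * x = 1) is left e then sval (cid e) else x.

Lemma classical_mulVr : {in classical_unit, left_inverse 1 classical_inv *%R}.
Proof.
move=> x /asboolP ux; rewrite /classical_inv; case: pselect => [e|//].
by case: (cid e).
Qed.

Lemma classical_unitPl x y : y * x = 1 -> classical_unit x.
Proof. by move=> yx; apply/asboolP; exists y. Qed.

Lemma classical_invr_out : {in [predC classical_unit], classical_inv =1 id}.
Proof.
move=> x; rewrite inE /= => /asboolP ux; rewrite /classical_inv.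
by case: pselect.
Qed.

End ClassicalUnits.

HB.instance Definition _ (k : fieldType) (D : kummer k) (R : comAlgType k) :=
  GRing.ComNzRing_hasMulInverse.Build (tw D R) (@classical_mulVr (tw D R))
    (@classical_unitPl (tw D R)) (@classical_invr_out (tw D R)).

Section CoordinateRing.

Variables (k : fieldType) (D : kummer k).

(* The coordinate ring of the torus is the algebra generated by the coordinates of
   the generic point; that it represents norm-one elements is [gpt_generic]. *)
Definition tcoord_pred : {pred gfun D} :=
  fun x => `[< exists P, x = poly_at (gpt D) P >].

Fact tcoord_pred_closed : GRing.subalg_closed tcoord_pred.
Proof.
split.
- by apply/asboolP; exists 1; rewrite rmorph1.
- move=> c x y /asboolP[P ->] /asboolP[Q ->]; apply/asboolP.
  by exists (c *: P + Q); rewrite linearP.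
- move=> x y /asboolP[P ->] /asboolP[Q ->]; apply/asboolP.
  by exists (P * Q); rewrite rmorphM.
Qed.

HB.instance Definition _ :=
  GRing.isSubalgClosed.Build k (gfun D) tcoord_pred tcoord_pred_closed.

Record tcoord := TCoord { tcoord_val :> gfun D; _ : tcoord_val \in tcoord_pred }.

HB.instance Definition _ := [isSub for tcoord_val].
HB.instance Definition _ := [Choice of tcoord by <:].
HB.instance Definition _ := [SubChoice_isSubAlgebra of tcoord by <:].
HB.instance Definition _ := [SubNzRing_isSubComNzRing of tcoord by <:].
HB.instance Definition _ := GRing.Lalgebra_isComAlgebra.Build k tcoord.
HB.instance Definition _ := GRing.ComNzRing_hasMulInverse.Build tcoord
    (@classical_mulVr tcoord) (@classical_unitPl tcoord) (@classical_invr_out tcoord).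

Definition tcoord_inc_fun (u : tcoord) : gfun D := tcoord_val u.

Fact tcoord_inc_is_zmod_morphism : zmod_morphism tcoord_inc_fun.
Proof. by []. Qed.

Fact tcoord_inc_is_monoid_morphism : monoid_morphism tcoord_inc_fun.
Proof. by []. Qed.

Fact tcoord_inc_is_scalable : scalable tcoord_inc_fun.
Proof. by []. Qed.

HB.instance Definition _ := GRing.isZmodMorphism.Build tcoord (gfun D)
  tcoord_inc_fun tcoord_inc_is_zmod_morphism.
HB.instance Definition _ := GRing.isMonoidMorphism.Build tcoord (gfun D)
  tcoord_inc_fun tcoord_inc_is_monoid_morphism.
HB.instance Definition _ := GRing.isScalable.Build k tcoord (gfun D) *:%R
  tcoord_inc_fun tcoord_inc_is_scalable.

Definition tcoord_inc : {lrmorphism tcoord -> gfun D} := tcoord_inc_fun.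

Lemma tcoord_inc_inj : injective tcoord_inc.
Proof. exact: val_inj. Qed.

Fact gpt_in_tcoord a : gpt D a \in tcoord_pred.
Proof. by apply/asboolP; exists 'X_(enum_rank a); rewrite poly_at_rank. Qed.

Definition univ : tw D tcoord := [ffun a => TCoord (gpt_in_tcoord a)].

Lemma tcoord_inc_univ : tw_map tcoord_inc univ = gpt D.
Proof. by apply/ffunP => a; rewrite !ffunE. Qed.

Lemma tw_norm_univ : tw_norm univ = 1.
Proof.
apply: tcoord_inc_inj.
by rewrite tw_map_norm tcoord_inc_univ tw_norm_gpt rmorph1.
Qed.

Lemma poly_at_univ P : tcoord_inc (poly_at univ P) = poly_at (gpt D) P.
Proof. by rewrite poly_at_map tcoord_inc_univ. Qed.

Lemma tcoordP (u : tcoord) : {P | u = poly_at univ P}.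
Proof.
have /asboolP/cid[P e] := valP u; exists P.
by apply: tcoord_inc_inj; rewrite poly_at_univ.
Qed.

Lemma tcoord_integral : GRing.integral_domain_axiom tcoord.
Proof.
move=> u v /(congr1 tcoord_inc)/eqP; rewrite rmorphM rmorph0 mulf_eq0.
by rewrite -(rmorph0 tcoord_inc) !(inj_eq tcoord_inc_inj).
Qed.

Lemma tcoord_finite_type : finite_type tcoord.
Proof.
by exists #|kidx D|, (poly_at univ) => u; case: (tcoordP u) => P ->; exists P.
Qed.

Section NormOneHom.

Variables (R : comAlgType k) (x : tw D R).
Hypothesis x1 : tw_norm x = 1.

Definition norm1_fun (u : tcoord) : R := poly_at x (sval (tcoordP u)).

(** The choice of polynomial is harmless: polynomials that agree at the generic point agree at every
    norm-one element, by [gpt_generic]. *)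
Lemma norm1_funE P : norm1_fun (poly_at univ P) = poly_at x P.
Proof.
rewrite /norm1_fun; case: tcoordP => Q /= e.
apply/eqP; rewrite -subr_eq0 -rmorphB; apply/eqP.
by apply: gpt_generic x1; rewrite rmorphB /= -!poly_at_univ -e subrr.
Qed.

Fact norm1_fun_is_zmod_morphism : zmod_morphism norm1_fun.
Proof.
move=> u v; case: (tcoordP u) (tcoordP v) => P -> [Q ->].
by rewrite -rmorphB !norm1_funE rmorphB.
Qed.

Fact norm1_fun_is_monoid_morphism : monoid_morphism norm1_fun.
Proof.
split=> [|u v]; first by rewrite -(rmorph1 (poly_at univ)) norm1_funE rmorph1.
case: (tcoordP u) (tcoordP v) => P -> [Q ->].
by rewrite -rmorphM !norm1_funE rmorphM.
Qed.

Fact norm1_fun_is_scalable : scalable norm1_fun.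
Proof.
by move=> c u; case: (tcoordP u) => P ->; rewrite -linearZ !norm1_funE linearZ.
Qed.

HB.instance Definition _ :=
  GRing.isZmodMorphism.Build tcoord R norm1_fun norm1_fun_is_zmod_morphism.
HB.instance Definition _ :=
  GRing.isMonoidMorphism.Build tcoord R norm1_fun norm1_fun_is_monoid_morphism.
HB.instance Definition _ :=
  GRing.isScalable.Build k tcoord R *:%R norm1_fun norm1_fun_is_scalable.

Definition norm1_hom : {lrmorphism tcoord -> R} := norm1_fun.

Lemma norm1_hom_univ : tw_map norm1_hom univ = x.
Proof.
apply/ffunP => a; rewrite ffunE -(poly_at_rank univ a).
by rewrite [LHS]norm1_funE poly_at_rank.
Qed.

End NormOneHom.

Lemma tcoord_hom_ext (R : comAlgType k) (f g : {lrmorphism tcoord -> R}) :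
  tw_map f univ = tw_map g univ -> f =1 g.
Proof.
by move=> e u; case: (tcoordP u) => P ->; rewrite !poly_at_map e.
Qed.

Definition norm1_var : variety k := Variety tcoord_integral tcoord_finite_type.

End CoordinateRing.

Section NormOneGroup.

Variables (k : fieldType) (D : kummer k).

Definition pt_elt (R : comUnitAlgType k) (f : points (norm1_var D) R) : tw D R :=
  tw_map (f : {lrmorphism tcoord D -> R}) (univ D).

Lemma pt_elt_norm (R : comUnitAlgType k) (f : points (norm1_var D) R) :
  tw_norm (pt_elt f) = 1.
Proof. by rewrite /pt_elt -tw_map_norm tw_norm_univ rmorph1. Qed.

Definition elt_pt (R : comUnitAlgType k) (x : tw D R) (x1 : tw_norm x = 1) :
  points (norm1_var D) R := norm1_hom x1.

Lemma elt_ptK (R : comUnitAlgType k) (x : tw D R) (x1 : tw_norm x = 1) :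
  pt_elt (elt_pt x1) = x.
Proof. exact: norm1_hom_univ. Qed.

Lemma pt_elt_inj (R : comUnitAlgType k) : injective (@pt_elt R).
Proof. by move=> f g e; apply: lrmorph_eq; apply: tcoord_hom_ext. Qed.

Lemma pt_elt_push (R R' : comUnitAlgType k) (h : {lrmorphism R -> R'})
  (f : points (norm1_var D) R) : pt_elt (push h f) = tw_map h (pt_elt f).
Proof.
rewrite /pt_elt; apply/ffunP => a.
by rewrite [RHS]ffunE [in RHS]ffunE [LHS]ffunE.
Qed.

Fact tgmul_subproof (R : comUnitAlgType k) (f g : points (norm1_var D) R) :
  tw_norm (pt_elt f * pt_elt g) = 1.
Proof. by rewrite tw_normM !pt_elt_norm mulr1. Qed.

Fact tginv_subproof (R : comUnitAlgType k) (f : points (norm1_var D) R) :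
  tw_norm (tw_cof (pt_elt f)) = 1.
Proof.
by have := tw_norm_cof (pt_elt f); rewrite pt_elt_norm expr1n mulr1.
Qed.

Definition tgmul R (f g : points (norm1_var D) R) := elt_pt (tgmul_subproof f g).
Definition tgone (R : comUnitAlgType k) : points (norm1_var D) R := elt_pt (tw_norm1 D R).
Definition tginv R (f : points (norm1_var D) R) := elt_pt (tginv_subproof f).

Fact tgmulA R : associative (@tgmul R).
Proof. by move=> f g h; apply: pt_elt_inj; rewrite !elt_ptK mulrA. Qed.

Fact tgmul1 R : left_id (tgone R) (@tgmul R).
Proof. by move=> f; apply: pt_elt_inj; rewrite !elt_ptK mul1r. Qed.

Fact tgmulV R : left_inverse (tgone R) (@tginv R) (@tgmul R).
Proof.
move=> f; apply: pt_elt_inj; rewrite !elt_ptK mulrC tw_mul_cof pt_elt_norm.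
by rewrite rmorph1.
Qed.

Fact tgmul_natural (R R' : comUnitAlgType k) (h : {lrmorphism R -> R'})
    (f g : points (norm1_var D) R) :
  push h (tgmul f g) = tgmul (push h f) (push h g).
Proof.
by apply: pt_elt_inj; rewrite pt_elt_push !elt_ptK rmorphM !pt_elt_push.
Qed.

Definition norm1_group : group_variety k :=
  GroupVariety tgmulA tgmul1 tgmulV tgmul_natural.

End NormOneGroup.

(** The characters identify the torus with families of units indexed by the group and of product 1.
    The member at 0 is the inverse of the product of the others, which are free. *)
Lemma norm1_group_split (k L : fieldType) (D : kummer k) (iota : {rmorphism k -> L})
    (e : kidx D -> L) :
    e 0 = 1 -> (forall a b, e a * e b = iota (kcoc a b) * e (a + b)) ->
  split_over (norm1_group D) iota #|[pred g : kidx D | g != 0]|.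
Proof.
move=> e0 eM; set n := #|_|.
exists (fun R j f => [ffun i : 'I_n => chi (fun a => j (e a)) (enum_val i) (pt_elt f)]).
split=> [R j hj|R R' h j hj f i]; last first.
  rewrite !ffunE pt_elt_push /chi raddf_sum; apply: eq_bigr => a _.
  by rewrite ffunE [RHS](rmorphM h) /= linearZ.
have fe : frame (D := D) (fun a => j (e a)).
  split=> [|a b]; first by rewrite e0 rmorph1.
  by rewrite -rmorphM eM rmorphM hj mulr_algl.
split=> [f i|f f' i|u uU].
- rewrite ffunE; have := pt_elt_norm f; rewrite (norm_chi fe) (bigD1 (enum_val i)) //=.
  by move=> e1; apply/unitrPr; eexists; exact: e1.
- by rewrite !ffunE elt_ptK chiM.
pose V := \prod_i (u i)^-1.
pose X g := if g == 0 then V else \prod_i (if enum_val i == g then u i else 1).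
have XE i : X (enum_val i) = u i.
  have := enum_valP i; rewrite inE /X => /negbTE ->.
  rewrite (bigD1 i) //= eqxx big1 ?mulr1 // => i' /negbTE ii'.
  by rewrite (inj_eq enum_val_inj) ii'.
have prod_nz F : \prod_(g | g != 0) F g = \prod_(i < n) F (enum_val i) :> R.
  by rewrite -big_enum_val.
have X1 : \prod_g X g = 1.
  rewrite (bigD1 0) //= {1}/X eqxx /V.
  rewrite prod_nz -big_split /=.
  by apply: big1 => i _; rewrite XE mulVr.
have x1 : tw_norm (ichi (fun a => j (e a)) X) = 1.
  by rewrite (norm_chi fe) -[RHS]X1; apply: eq_bigr => g _; rewrite ichiK.
exists (elt_pt x1); split.
  by apply/ffunP => i; rewrite ffunE elt_ptK ichiK.
move=> f fu; apply: pt_elt_inj; rewrite elt_ptK; apply: (chi_inj fe) => g.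
have chif i : chi (fun a => j (e a)) (enum_val i) (pt_elt f) = u i by rewrite -fu ffunE.
have chif' h : h != 0 -> chi (fun a => j (e a)) h (pt_elt f) = X h.
  move=> h0; have hA : h \in [pred g : kidx D | g != 0] by [].
  by rewrite -(enum_rankK_in hA hA) chif XE.
rewrite ichiK //; have [->|/chif' //] := eqVneq g 0.
have := pt_elt_norm f; rewrite (norm_chi fe) -[RHS]X1 (bigD1 0) //= [RHS](bigD1 0) //=.
rewrite [X in _ * X = _](eq_bigr X) => [|h /chif' //].
have PU : \prod_(h | h != 0) X h \is a GRing.unit.
  by rewrite prod_nz; apply: rpred_prod => i _; rewrite XE.
by move/esym/(mulIr PU).
Qed.

(** * The cover of the torus by its base change *)

Section Points.

Variables (k : fieldType) (X Y : variety k) (h : {rmorphism coord X -> coord Y}).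

(** A kernel in a domain is a point: the identity gives the generic point, a comorphism the image of
    the generic point. *)
Definition ker_pred : {pred coord X} := fun u => h u == 0.

Fact ker_pred_closed : idealr_closed ker_pred.
Proof.
split=> [||u v w]; rewrite ?unfold_in /ker_pred.
- by rewrite /= rmorph0.
- by rewrite rmorph1 oner_eq0.
- by move=> /eqP v0 /eqP w0; rewrite rmorphD rmorphM v0 w0 mulr0 addr0.
Qed.

Fact ker_pred_prime : prime_idealr_closed ker_pred.
Proof. by move=> u v; rewrite !unfold_in /ker_pred rmorphM mulf_eq0. Qed.

HB.instance Definition _ := isIdealr.Build (coord X) ker_pred ker_pred_closed.
HB.instance Definition _ := isPrimeIdealrClosed.Build (coord X) ker_pred ker_pred_prime.

Definition ker_point : point X := ker_pred.

Lemma ker_pointE u : (u \in ker_point) = (h u == 0).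
Proof. by []. Qed.

End Points.

Lemma sum_enum_val (I : finType) (V : nmodType) (F : I -> V) :
  \sum_a F a = \sum_(i < #|I|) F (enum_val i).
Proof. exact: (reindex _ (onW_bij _ (enum_val_bij I))). Qed.

Section RetractPositive.

Variables (k : fieldType) (D : kummer k).
Hypothesis tw_dom : GRing.integral_domain_axiom (tw D (gfun D)).

Local Notation A := (tcoord D).

Lemma tw_tcoord_integral : GRing.integral_domain_axiom (tw D A).
Proof.
have inj : injective (tw_map (D := D) (tcoord_inc D)).
  move=> x y /ffunP e; apply/ffunP => a; have := e a.
  by rewrite !ffunE => /tcoord_inc_inj.
move=> x y xy; have /tw_dom/orP : tw_map (tcoord_inc D) x * tw_map (tcoord_inc D) y = 0.
  by rewrite -rmorphM xy rmorph0.
by case=> /eqP e0; apply/orP; [left|right]; apply/eqP; apply: inj; rewrite e0 rmorph0.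
Qed.

Lemma tw_tcoord_finite_type : finite_type (tw D A : comUnitAlgType k).
Proof.
pose N := #|kidx D|.
(* Generators: the coordinates of the universal point, then the basis elements e_a. *)
pose v (i : 'I_(N + N)) : tw D A := match split i with
  | inl j => tw_inc D (univ D (enum_val j)) | inr j => tw_delta A (enum_val j) end.
exists (N + N)%N, (mpoly_eval v) => x.
pose q a : {mpoly k[N + N]} :=
  mpoly_eval (fun i => 'X_(lshift N i)) (sval (tcoordP (x a))).
exists (\sum_a q a * 'X_(rshift N (enum_rank a))).
rewrite raddf_sum [RHS]tw_sum_delta; apply: eq_bigr => a _.
rewrite /= rmorphM /= mpoly_evalX /v (unsplitK (inr (enum_rank a))) enum_rankK.
congr (_ * _); rewrite /q; case: tcoordP => P /= ->.
rewrite mpoly_eval_comp poly_at_map; apply: mpoly_lrmorph_ext P => i.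
rewrite [RHS]poly_atX [LHS]mpoly_evalX [LHS]mpoly_evalX /v (unsplitK (inl i)).
by rewrite [RHS]ffunE.
Qed.

Definition norm1_cover : variety k := Variety tw_tcoord_integral tw_tcoord_finite_type.

Definition cover_map : morphism norm1_cover (norm1_var D) :=
  @tw_inc k D A : {lrmorphism A -> tw D A}.

Lemma cover_finite : finite cover_map.
Proof.
exists #|kidx D|, (fun i => tw_delta A (enum_val i)) => y.
exists (fun i => (y : tw D A) (enum_val i)).
rewrite [LHS](tw_sum_delta (y : tw D A)).
exact: sum_enum_val.
Qed.

Lemma cover_dominant : dominant cover_map.
Proof.
move=> g [P gP]; have g0 : g != 0.
  by apply/eqP => g0; move: gP; rewrite g0 idealr0.
exists (ker_point (idfun : {rmorphism coord norm1_cover -> coord norm1_cover})).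
exists (ker_point (idfun : {rmorphism coord (norm1_var D) -> coord (norm1_var D)})).
split; last by rewrite ker_pointE.
move=> a; rewrite !ker_pointE /=.
by rewrite -(rmorph0 (@tw_inc k D A)) (inj_eq (@tw_inc_inj _ _ _)).
Qed.

Lemma common_denominator (R : idomainType) (n : nat) (x : 'I_n -> {fraction R}) :
  exists2 d : R, d != 0 & forall i, exists a : R, x i * d%:F = a%:F.
Proof.
exists (\prod_i (s2val (fracP (x i))).2).
  by apply/prodf_neq0 => i _; case: fracP.
move=> i; rewrite (bigD1 i) //=; case: (fracP (x i)) => -[u v] /= v0 {1}->.
by rewrite rmorphM mulrA divfK ?tofrac_eq0 // -rmorphM; eexists.
Qed.

End RetractPositive.

Section RetractPositiveDegree.

Variables (k : fieldType) (D : kummer k).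
Hypothesis tw_dom : GRing.integral_domain_axiom (tw D (gfun D)).

Local Notation A := (tcoord D).
Local Notation X := (norm1_var D).
Local Notation X' := (norm1_cover tw_dom).
Local Notation inc := (@cover_map k D tw_dom).

Lemma cover_inc_inj : injective inc.
Proof. exact: tw_inc_inj. Qed.

Lemma cover_norm_neq0 (m : tw D A) : m != 0 -> tw_norm m != 0.
Proof.
move=> m0; apply/eqP => e; have := tw_normE m; rewrite e rmorph0 => /esym/eqP.
have dom : GRing.integral_domain_axiom (tw D A) := tw_tcoord_integral tw_dom.
apply/negP; elim/big_ind: _ => [||g _].
- exact: oner_neq0.
- by move=> x y x0 y0; apply/eqP => /dom; rewrite (negbTE x0) (negbTE y0).
apply/eqP => /(congr1 (tw_act (- g))); rewrite -tw_actD addNr tw_act0 rmorph0.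
exact/eqP.
Qed.

(** The e_a form a basis of the function field: they are independent after clearing denominators,
    and n / m is n times the cofactor of m, divided by the norm of m, which lies in the coordinate
    ring of the torus. *)
Lemma cover_degree : has_degree inc #|kidx D|.
Proof.
have tf_inj : injective (@tofrac (coord X')).
  by move=> u v /eqP; rewrite tofrac_eq => /eqP.
pose h : {rmorphism coord X -> {fraction coord X'}} := @tofrac (coord X') \o inc.
have h_inj : injective h by apply: inj_comp tf_inj cover_inc_inj.
pose phi := frac_rmorph h_inj.
have phiE a : phi a%:F = (inc a)%:F by apply: frac_rmorphE.
exists phi; split=> //.
pose b (a : kidx D) : coord X' := tw_delta A a.
exists (fun i => (b (enum_val i))%:F) => y.
pose cf (c : {ffun 'I_#|kidx D| -> {fraction coord X}}) :=
  \sum_i phi (c i) * (b (enum_val i))%:F.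
have cf0 c : cf c = 0 -> c = 0.
  have [d d0 dE] := common_denominator c.
  move=> c0; have : cf c * phi d%:F = 0 by rewrite c0 mul0r.
  have [a aE] : exists a : 'I_#|kidx D| -> coord X, forall i, c i * d%:F = (a i)%:F.
    by exists (fun i => sval (cid (dE i))) => i; case: cid.
  rewrite /cf mulr_suml (eq_bigr (fun i => (inc (a i) * b (enum_val i))%:F)); last first.
    by move=> i _; rewrite mulrAC -rmorphM aE phiE -rmorphM.
  rewrite -rmorph_sum /= => /eqP; rewrite tofrac_eq0 => /eqP e.
  apply/ffunP => i; rewrite ffunE; apply: (mulIf (_ : d%:F != 0)); rewrite ?tofrac_eq0 //.
  rewrite mul0r aE; suff -> : a i = 0 by rewrite tofrac0.
  have {e} : \sum_j tw_inc D (a (enum_rank j) : A) * tw_delta A j = 0.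
    by rewrite sum_enum_val -[RHS]e; apply: eq_bigr => j _; rewrite enum_valK.
  move/ffunP/(_ (enum_val i)); rewrite sum_ffunE (bigD1 (enum_val i)) //= big1.
    by rewrite tw_incM !ffunE eqxx mulr1 addr0 enum_valK.
  by move=> j ji; rewrite tw_incM ffunE eq_sym (negbTE ji) mulr0.
case: (fracP y) => -[n m] /= m0 ->.
pose N : coord X := tw_norm (m : tw D A).
pose z : tw D A := (n : tw D A) * tw_cof (m : tw D A).
have N0 : N != 0 by apply: cover_norm_neq0.
pose c0 : {ffun 'I_#|kidx D| -> {fraction coord X}} :=
  [ffun i => (z (enum_val i) : coord X)%:F / N%:F].
have c0E : n%:F / m%:F = cf c0.
  apply: (mulIf (_ : (inc N)%:F != 0)).
    by rewrite -phiE fmorph_eq0 tofrac_eq0.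
  rewrite mulr_suml (eq_bigr (fun i => (inc (z (enum_val i)) * b (enum_val i))%:F)).
    rewrite -rmorph_sum /= -(sum_enum_val (fun a => tw_inc D (z a) * tw_delta A a)).
    rewrite -tw_sum_delta; have m0' : m%:F != 0 by rewrite tofrac_eq0.
    apply: (mulIf m0'); rewrite mulrAC divfK // -!rmorphM; congr (_ %:F).
    by rewrite /z -[RHS]mulrA [_ * m]mulrC; congr (_ * _); rewrite tw_mul_cof.
  move=> i _; rewrite ffunE mulrAC fmorph_div !phiE divfK -?rmorphM //.
  by rewrite -phiE fmorph_eq0 tofrac_eq0.
exists c0; split=> // c' e; apply/eqP; rewrite -subr_eq0; apply/eqP; apply: cf0.
transitivity (cf c0 - cf c'); last by rewrite -c0E e subrr.
rewrite /cf -sumrB; apply: eq_bigr => i _.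
by rewrite ffunE [X in _ + X]ffunE rmorphB mulrBl.
Qed.

(** [norm1_spec] writes the universal point over the cover as a product of quotients; their
    arguments w define [s], and [pi] is the generic point, as an inclusion of rings. *)
Lemma norm1_retract (p : nat) :
  ~~ (p %| #|kidx D|)%N -> p_retract_rational p X.
Proof.
move=> pN; pose u := tw_map (@tw_inc k D A) (univ D).
have u1 : tw_norm u = 1 by rewrite -tw_map_norm tw_norm_univ rmorph1.
have [w w1 wu] := norm1_spec (tw_delta_frame D A) u1.
pose s : morphism X' (affine_space k (gdim D)) := spec w.
have piP c : tcoord_inc D c%:A = (c%:A : coord (affine_space k (gdim D)))%:F.
  by rewrite rmorph_alg -[RHS]/(torat c%:A) rmorph_alg.
pose pi := RationalMap (X := X) (Y := affine_space k (gdim D)) piP.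
have piE a : exists (M : nat) (Q : {mpoly k[gdim D]}),
    tcoord_inc D a * torat (gden D) ^+ M = torat Q /\ s Q = inc a.
  case: (tcoordP a) => P ->; have [M [Q [e1 e2]]] := gpt_poly_at P.
  exists M, Q; split; first by rewrite poly_at_univ.
  by rewrite [LHS]e2 // wu -poly_at_map.
exists (gdim D), X', inc, #|kidx D|, s, pi; split.
  split=> //; [exact: cover_finite|exact: cover_dominant|exact: cover_degree].
split.
  (* The generic point of the cover serves: [s] sends [gden] to 1, so its image lies off the zeros
     of the denominator. *)
  exists (ker_point (idfun : {rmorphism coord X' -> coord X'})).
  exists (ker_point s); split; first by move=> a; rewrite !ker_pointE.
  exists (gden D : coord (affine_space k (gdim D))) => [|a].
    by rewrite ker_pointE; apply/eqP => /(etrans (esym w1))/eqP; rewrite oner_eq0.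
  have [M [Q [e _]]] := piE a; exists M, Q.
  have d0 : torat (gden D) ^+ M != 0 by rewrite expf_neq0 // torat_eq0 gden_neq0.
  apply: (mulIf d0); rewrite [LHS]e; apply/esym.
  by rewrite -rmorphXn; apply: divfK; rewrite tofrac_eq0 expf_neq0 // gden_neq0.
move=> a u' v' sv e; have [M [Q [eQ sQ]]] := piE a.
have v0 : v' != 0 by apply: contraNneq sv => ->; rewrite rmorph0.
have {e} e : u' * gden D ^+ M = v' * Q.
  have v0' : torat v' != 0 by rewrite torat_eq0.
  have e' : torat u' / torat v' * torat (gden D) ^+ M = torat Q.
    by rewrite -eQ; congr (_ * _); exact: esym e.
  apply: torat_inj; rewrite !rmorphM rmorphXn /= -e' mulrA.
  by rewrite [torat v' * _]mulrCA divff // mulr1.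
have su : s u' = s v' * inc a.
  have dM : spec w (gden D ^+ M) = 1 by rewrite rmorphXn /= w1 expr1n.
  by have := congr1 (spec w) e; rewrite -sQ !rmorphM /= dM mulr1.
by rewrite su rmorphM mulrAC divff ?mul1r // tofrac_eq0.
Qed.

End RetractPositiveDegree.

(** * The obstruction *)

(** The integers below [size p] are distinct in k and outnumber the roots of p. *)
Lemma poly_nonroot (k : fieldType) (p : {poly k}) :
  (forall n, n.+1%:R != 0 :> k) -> p != 0 -> exists t, p.[t] != 0.
Proof.
move=> char0 p0; pose s : seq k := [seq i%:R | i <- iota 0 (size p)].
have us : uniq s.
  rewrite map_inj_uniq ?iota_uniq //.
  suff H i j : (i <= j)%N -> i%:R = j%:R :> k -> i = j.
    by move=> i j ij; case/orP: (leq_total i j) => /H; [exact|move=> ->].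
  move=> /subnKC <- /eqP; rewrite natrD eq_sym -subr_eq0 addrAC subrr add0r.
  by case: (j - i)%N => [|m]; rewrite ?addn0 // (negbTE (char0 m)).
have [/max_poly_roots - /(_ p0 us)|/allPn[t _ pt]] := boolP (all (root p) s).
  by rewrite size_map size_iota ltnn.
by exists t.
Qed.

(** Induction on the variables: avoid the zeros of the leading coefficient in the last variable,
    then the roots of the remaining univariate polynomial. *)
Lemma mpoly_nonroot (k : fieldType) (n : nat) (p : {mpoly k[n]}) :
  (forall m, m.+1%:R != 0 :> k) -> p != 0 -> exists v, p.@[v] != 0.
Proof.
move=> char0; elim: n p => [|n IHn] p p0.
  have mE m : m = 0%MM :> 'X_{1..0} by apply/mnmP => -[].
  have pE : p = (p@_0%MM)%:MP by apply/mpolyP => m; rewrite (mE m) mcoeffC eqxx mulr1.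
  exists (fun=> 0); apply: contraNneq p0; rewrite pE mevalC => ->.
  by rewrite mpolyC0.
pose v i : {poly {mpoly k[n]}} := if unlift ord_max i is Some j then ('X_j)%:P else 'X.
have [uni [uniC uniX]] : exists uni : {rmorphism {mpoly k[n.+1]} -> {poly {mpoly k[n]}}},
    (forall c, uni c%:MP = (c%:MP)%:P) /\ (forall i, uni 'X_i = v i).
  exists (mmap (polyC \o @mpolyC n k) v).
  by split=> [c|i] /=; rewrite ?mmapC ?mmapX ?mmap1U.
pose lft : {lrmorphism {mpoly k[n]} -> {mpoly k[n.+1]}} :=
  mpoly_eval (fun j => 'X_(lift ord_max j)).
(* A left inverse of [uni], to show that [uni p] is nonzero. *)
pose back (q : {poly {mpoly k[n]}}) := (map_poly lft q).['X_ord_max].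
have backD q r : back (q + r) = back q + back r by rewrite /back rmorphD hornerD.
have backM q r : back (q * r) = back q * back r by rewrite /back rmorphM hornerM.
have uniK : cancel uni back.
  elim/mpoly_ringind => [c|i|q r eq er|q r eq er].
  - by rewrite uniC /back map_polyC hornerC /= -!alg_mpolyC rmorph_alg.
  - rewrite uniX /v /back; case: unliftP => [j|] ->.
      by rewrite map_polyC hornerC /= mpoly_evalX.
    by rewrite map_polyX hornerX.
  - by rewrite (rmorphD uni) backD eq er.
  - by rewrite (rmorphM uni) backM eq er.
have [w w0] : exists w, (lead_coef (uni p)).@[w] != 0.
  apply: IHn; rewrite lead_coef_eq0; apply: contra p0 => /eqP e.
  by rewrite -[p]uniK e /back rmorph0 horner0.
have [|t t0] := poly_nonroot (p := map_poly (meval w) (uni p)) char0.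
  apply: contraNneq w0 => /polyP/(_ (size (uni p)).-1).
  by rewrite coef_map coef0 => <-.
exists (fun i => if unlift ord_max i is Some j then w j else t).
suff -> q : q.@[fun i => if unlift ord_max i is Some j then w j else t] =
            (map_poly (meval w) (uni q)).[t] by [].
elim/mpoly_ringind: q => [c|i|q r eq er|q r eq er].
- by rewrite uniC map_polyC hornerC /= !mevalC.
- rewrite uniX mevalXU /v; case: unliftP => [j|] _.
    by rewrite map_polyC hornerC /= mevalXU.
  by rewrite map_polyX hornerX.
- by rewrite (rmorphD uni) rmorphD /= eq er [in RHS]rmorphD hornerD.
- by rewrite (rmorphM uni) rmorphM /= eq er [in RHS]rmorphM hornerM.
Qed.

(** * Irreducible factors, and polynomials with equal norms under a finite group *)

Section IrreducibleFactors.

Variable E : fieldType.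
Implicit Types p q : {poly E}.

Lemma irreducible_factor p :
  (1 < size p)%N -> exists2 q, irreducible_poly q & q %| p.
Proof.
have [n] := ubnP (size p); elim: n p => // n IHn p /ltnSE pn p1.
have [ip|nip] := pselect (irreducible_poly p); first by exists p.
have [q qp] : exists q, ~ (size q != 1 -> q %| p -> q %= p).
  by apply/existsNP => h; apply: nip; split.
have /not_implyP[q1 /not_implyP[dqp /negP nqp]] := qp.
have p0 : p != 0 by rewrite -size_poly_gt0 ltnW.
have q0 : q != 0 by apply: contraNneq p0 => q0; move: dqp; rewrite q0 dvd0p.
have qn : (size q < size p)%N.
  by rewrite ltn_neqAle dvdp_leq // andbT dvdp_size_eqp.
have [||r ir rq] := IHn q.
- exact: leq_trans qn pn.
- by case: (size q) q1 (size_poly_gt0 q) => [|[|m]] //; rewrite q0.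
by exists r => //; apply: dvdp_trans rq dqp.
Qed.

Lemma irreducible_dvdM q a b :
  irreducible_poly q -> q %| a * b -> (q %| a) || (q %| b).
Proof.
move=> iq qab; have [//|nqa] := boolP (q %| a).
have [g1|g1] := eqVneq (size (gcdp q a)) 1%N.
  by rewrite -(Gauss_dvdpr _ (_ : coprimep q a)) // /coprimep g1.
have := iq.2 _ g1 (dvdp_gcdl q a) => /andP[_ qg].
by have := dvdp_trans qg (dvdp_gcdr q a); rewrite (negbTE nqa).
Qed.

Lemma irreducible_dvd_prod (I : finType) q (F : I -> {poly E}) :
  irreducible_poly q -> q %| \prod_i F i -> exists i, q %| F i.
Proof.
move=> iq; elim/big_ind: _ => [|a b IHa IHb|i _ qi]; last by exists i.
  by rewrite dvdp1 => /eqP q1; have := iq.1; rewrite q1.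
by move/(irreducible_dvdM iq)/orP => [/IHa|/IHb].
Qed.

End IrreducibleFactors.

Section NormEquation.

Variables (I : finZmodType) (E C : fieldType).
Variables (gam : I -> {rmorphism E -> E}) (mu : E -> C).

Hypothesis gamD : forall g h x, gam (g + h) x = gam g (gam h x).
Hypothesis gam0 : forall x, gam 0 x = x.
Hypothesis muM : {morph mu : x y / x * y}.
Hypothesis mu_gam : forall g x, mu (gam g x) = mu x.

Local Notation Gam g := (map_poly (gam g)).

Lemma GamD g h p : Gam (g + h) p = Gam g (Gam h p).
Proof. by apply/polyP => i; rewrite !coef_map /= gamD. Qed.

Lemma Gam0 p : Gam 0 p = p.
Proof. by apply/polyP => i; rewrite coef_map /= gam0. Qed.

Definition gam_norm p := \prod_g Gam g p.

Lemma gam_normM p q : gam_norm (p * q) = gam_norm p * gam_norm q.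
Proof. by rewrite /gam_norm -big_split; apply: eq_bigr => g _; rewrite rmorphM. Qed.

Lemma gam_norm_Gam h p : gam_norm (Gam h p) = gam_norm p.
Proof.
rewrite /gam_norm [RHS](reindex_inj (addIr h)) /=.
by apply: eq_bigr => g _; rewrite GamD.
Qed.

Lemma gam_norm_neq0 p : p != 0 -> gam_norm p != 0.
Proof. by move=> p0; apply/prodf_neq0 => g _; rewrite map_poly_eq0. Qed.

Lemma dvdp_gam_norm p : p %| gam_norm p.
Proof. by rewrite /gam_norm (bigD1 0) //= Gam0 dvdp_mulr. Qed.

(* Evaluating at two invariant points, [mu] cannot distinguish two polynomials
   of equal norm: their irreducible factors agree up to conjugation. *)
Lemma gam_norm_eq (s t : E) (p q : {poly E}) :
    (forall g, gam g s = s) -> (forall g, gam g t = t) ->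
    p != 0 -> gam_norm p = gam_norm q ->
  mu p.[s] * mu q.[t] = mu p.[t] * mu q.[s].
Proof.
move=> gs gt; have [n] := ubnP (size p); elim: n p q => // n IHn p q /ltnSE pn p0 pq.
have q0 : q != 0.
  apply: contraTneq (gam_norm_neq0 p0) => q0; rewrite pq q0 negbK.
  by rewrite /gam_norm (bigD1 0) //= Gam0 mul0r.
(* If p is constant, so is its norm, and then q, which divides the same norm. *)
have [p1|p1] := leqP (size p) 1.
  have [a pa] : exists a, p = a%:P by exists p`_0; apply: size1_polyC.
  have [b qb] : exists b, q = b%:P.
    exists q`_0; apply: size1_polyC; apply: leq_trans (dvdp_leq _ (dvdp_gam_norm q)) _.
      exact: gam_norm_neq0.
    rewrite -pq pa /gam_norm (eq_bigr (fun g => (gam g a)%:P)).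
      by rewrite -rmorph_prod size_polyC leq_b1.
    by move=> g _; rewrite map_polyC.
  by rewrite pa qb !hornerC.
have [r ir /dvdpP[p' pE]] := irreducible_factor p1.
have /(irreducible_dvd_prod ir)[g rg] : r %| gam_norm q.
  by rewrite -pq; apply: dvdp_trans (dvdp_gam_norm p); rewrite pE dvdp_mull.
(* The factor r of p divides a conjugate of q, so a conjugate of r divides q; both are removed
   before the induction. *)
have /dvdpP[q' qE] : Gam (- g) r %| q.
  by rewrite -[q]Gam0 -(addNr g) GamD dvdp_map.
have r0 := irredp_neq0 ir.
have p'0 : p' != 0 by apply: contraNneq p0 => p'0; rewrite pE p'0 mul0r.
have pq' : gam_norm p' = gam_norm q'.
  apply: (mulIf (gam_norm_neq0 r0)); rewrite -gam_normM -pE pq qE gam_normM.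
  by rewrite gam_norm_Gam.
have p'n : (size p' < n)%N.
  apply: leq_trans pn; rewrite pE size_mul //.
  by move: ir.1; case: (size r) => [|[|m]] // _; rewrite addnS /= addnS ltnS leq_addr.
(* At an invariant point a conjugate polynomial takes the conjugate value, which has the same image
   under [mu]. *)
have ev x : (forall h, gam h x = x) -> mu (Gam (- g) r).[x] = mu r.[x].
  by move=> gx; rewrite -[in LHS](gx (- g)) horner_map mu_gam.
rewrite pE qE !hornerM !muM !ev // [LHS]mulrACA [RHS]mulrACA IHn //.
by congr (_ * _); exact: mulrC.
Qed.

End NormEquation.

(** Multiplication matrices in the basis [b]; their determinants are norms from M to F. *)
Lemma regular_representation (F M : fieldType) (phi : {rmorphism F -> M}) (d : nat)
    (b : 'I_d.+1 -> M) :
    (forall y, exists! c : {ffun 'I_d.+1 -> F}, y = \sum_i phi (c i) * b i) ->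
  exists rho : {rmorphism M -> 'M[F]_d.+1}, forall a, rho (phi a) = a%:M.
Proof.
move=> bP; pose cf y := sval (cid (bP y)).
have cfE y : y = \sum_i phi (cf y i) * b i by rewrite /cf; case: cid => c /= [].
have cf_uniq y (c : {ffun 'I_d.+1 -> F}) : y = \sum_i phi (c i) * b i -> cf y = c.
  by rewrite /cf; case: cid => c' /= [_ h] /h.
pose r y : 'M[F]_d.+1 := \matrix_(i, j) cf (y * b i) j.
have rE y i : y * b i = \sum_j phi (r y i j) * b j.
  by rewrite [LHS]cfE; apply: eq_bigr => j _; rewrite mxE.
have r_uniq y (A : 'M[F]_d.+1) :
    (forall i, y * b i = \sum_j phi (A i j) * b j) -> r y = A.
  move=> yA; apply/matrixP => i j; rewrite mxE.
  rewrite (cf_uniq (y * b i) [ffun j => A i j]) ?ffunE // yA.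
  by apply: eq_bigr => l _; rewrite ffunE.
have rB : zmod_morphism r.
  move=> x y; apply: r_uniq => i; rewrite mulrBl !rE -sumrB.
  by apply: eq_bigr => j _; rewrite !mxE rmorphB mulrBl.
have rC a : r (phi a) = a%:M.
  apply: r_uniq => i; rewrite (bigD1 i) //= big1 => [|j ji].
    by rewrite mxE eqxx mulr1n addr0.
  by rewrite mxE eq_sym (negbTE ji) mulr0n rmorph0 mul0r.
have rM : monoid_morphism r.
  split=> [|x y]; first by rewrite -(rmorph1 phi) rC.
  (* Rows hold the coordinates of y * b i, so the order of the factors is restored by commutativity
     of M. *)
  apply: r_uniq => i; rewrite [x * y]mulrC -mulrA rE mulr_sumr.
  transitivity (\sum_l \sum_j phi (r x i l * r y l j) * b j).
    apply: eq_bigr => l _; rewrite mulrCA rE mulr_sumr.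
    by apply: eq_bigr => j _; rewrite mulrA -rmorphM.
  rewrite exchange_big; apply: eq_bigr => j _ /=.
  by rewrite -mulr_suml -rmorph_sum mxE.
pose R : {rmorphism M -> 'M[F]_d.+1} := HB.pack r
  (GRing.isZmodMorphism.Build M 'M[F]_d.+1 r rB)
  (GRing.isMonoidMorphism.Build M 'M[F]_d.+1 r rM).
by exists R.
Qed.

(* A straight line joining the generic point of the image of [s] to the constant
   point [v], seen through a matrix representation of the function field. *)
Lemma matrix_homotopy (k F M : fieldType) (n d : nat) (j : {rmorphism k -> M})
    (i : {rmorphism k -> F}) (rho : {rmorphism M -> 'M[F]_d.+1})
    (s : 'I_n -> M) (v : 'I_n -> k) :
    (forall c, rho (j c) = (i c)%:M) ->
  exists theta : {rmorphism {mpoly k[n]} -> 'M[{poly F}]_d.+1},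
  [/\ forall c, theta c%:MP = (i c)%:P%:M,
      forall q, map_mx (horner_eval 0) (theta q) = rho (mmap j s q)
    & forall q, map_mx (horner_eval 1) (theta q) = (i q.@[v])%:M].
Proof.
move=> rj.
pose y l : {poly M} := (1 - 'X) * (s l)%:P + 'X * (j (v l))%:P.
pose P : {rmorphism {mpoly k[n]} -> {poly M}} := mmap (polyC \o j) y.
pose rho' : {rmorphism M -> 'M[{poly F}]_d.+1} := map_mx polyC \o rho.
have rhoX : commr_rmorph rho' ('X%:M : 'M[{poly F}]_d.+1).
  by move=> a; apply/esym/comm_mx_scalar.
pose H : {rmorphism {poly M} -> 'M[{poly F}]_d.+1} := horner_morph rhoX.
have HC a : H a%:P = rho' a by apply: horner_morphC.
have HX : H 'X = 'X%:M by apply: horner_morphX.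
have ev (t : F) (t' : M) : rho t' = t%:M ->
    forall r, map_mx (horner_eval t) (H r) = rho r.[t'].
  move=> tt'; elim/poly_ind => [|r a IHr].
    by rewrite horner0 !rmorph0.
  rewrite (rmorphD H) (rmorphM H) HC HX hornerMXaddC (rmorphD rho) (rmorphM rho) tt' -IHr.
  rewrite map_mxD map_mxM map_scalar_mx /=; congr (_ *m _%:M + _).
    by rewrite /horner_eval hornerX.
  by apply/matrixP => a1 a2; rewrite !mxE /horner_eval hornerC.
have PC c : P c%:MP = (j c)%:P by rewrite /P /= mmapC.
have PX l : P 'X_l = y l by rewrite /P /= mmapX mmap1U.
have P0 q : (P q).[0] = mmap j s q.
  elim/mpoly_ringind: q => [c|l|q r eq er|q r eq er].
  - by rewrite PC hornerC mmapC.
  - by rewrite PX mmapX mmap1U /y !hornerE ?subr0 ?mul0r ?addr0 ?mul1r.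
  - by rewrite !rmorphD hornerD eq er.
  - by rewrite !rmorphM hornerM eq er.
have P1 q : (P q).[1] = j q.@[v].
  elim/mpoly_ringind: q => [c|l|q r eq er|q r eq er].
  - by rewrite PC hornerC mevalC.
  - by rewrite PX mevalXU /y !hornerE ?subrr ?mul0r ?add0r ?mul1r.
  - by rewrite rmorphD hornerD eq er mevalD rmorphD.
  - by rewrite rmorphM hornerM eq er mevalM rmorphM.
exists (H \o P); split=> [c|q|q] /=.
- rewrite /P /= mmapC HC /rho' /= rj; apply/matrixP => a1 a2; rewrite !mxE.
  by rewrite rmorphMn.
- by rewrite (ev 0 0) ?P0 // rmorph0 -scalemx1 scale0r.
- by rewrite (ev 1 1) ?rmorph1 // P1 rj.
Qed.

Section Detector.

Variables (k E C : fieldType) (D : kummer k) (kap : {rmorphism k -> E}).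
Variables (e : kidx D -> E) (gam : kidx D -> {rmorphism E -> E}) (mu : E -> C).

Hypothesis e0 : e 0 = 1.
Hypothesis eM : forall a b, e a * e b = kap (kcoc a b) * e (a + b).
Hypothesis gam_e : forall g a, gam g (e a) = kap (kch g a) * e a.
Hypothesis gamD : forall g h x, gam (g + h) x = gam g (gam h x).
Hypothesis gam0 : forall x, gam 0 x = x.
Hypothesis muM : {morph mu : x y / x * y}.
Hypothesis mu_eq0 : forall x, (mu x == 0) = (x == 0).
Hypothesis mu_gam : forall g x, mu (gam g x) = mu x.

Lemma mu1 : mu 1 = 1.
Proof.
have m0 : mu 1 != 0 by rewrite mu_eq0 oner_eq0.
by apply: (mulfI m0); rewrite -muM !mulr1.
Qed.

Lemma muX x n : mu (x ^+ n) = mu x ^+ n.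
Proof. by elim: n => [|n IHn]; rewrite ?expr0 ?mu1 // !exprS muM IHn. Qed.

Variables (F M : fieldType) (n d : nat).
Variables (i : {rmorphism k -> F}) (j : {rmorphism k -> M}) (G : {rmorphism F -> E}).
Variables (rho : {rmorphism M -> 'M[F]_d.+1}) (s : 'I_n -> M).
Variables (V : tw D {mpoly k[n]}) (b : {mpoly k[n]}) (x : kidx D -> F).

Hypothesis rho_j : forall c, rho (j c) = (i c)%:M.
Hypothesis G_i : forall c, G (i c) = kap c.
Hypothesis gam_G : forall g y, gam g (G y) = G y.
Hypothesis normV : tw_norm V = b ^+ #|kidx D|.
Hypothesis sb_neq0 : mmap j s b != 0.
Hypothesis sV : forall a, rho (mmap j s (V a)) = rho (mmap j s b) * (x a)%:M.

(** Since V / b has norm one, the determinants [H V] and [H (tw_inc D b)] along the line have equal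
    G-norms, and [gam_norm_eq] compares their values at the two ends. At 0 their quotient is a power
    of the norm-one element with coordinates x; at 1 it is the same power of the constant V(v) /
    b(v). The exponent [d.+1] is the size of the matrices. *)
Lemma detector_eq (v : 'I_n -> k) : b.@[v] != 0 ->
  mu (\sum_a G (x a) * e a) ^+ d.+1 * mu (kap b.@[v]) ^+ d.+1 =
  mu (\sum_a kap (V a).@[v] * e a) ^+ d.+1.
Proof.
move=> bv; have [theta [thC th0 th1]] := matrix_homotopy s v rho_j.
pose Gp := map_poly G.
pose th : {rmorphism {mpoly k[n]} -> 'M[{poly E}]_d.+1} := map_mx Gp \o theta.
pose eps a : 'M[{poly E}]_d.+1 := (e a)%:P%:M.
have thP c : th c%:MP = (kap c)%:P%:M.
  by rewrite /th /= thC map_scalar_mx /= /Gp map_polyC /= G_i.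
have thZ c q : th (c *: q) = (kap c)%:P%:M * th q.
  by rewrite -mul_mpolyC rmorphM thP.
have eps0 : eps 0 = 1 by rewrite /eps e0.
have epsM a a' : eps a * eps a' = th (kcoc a a')%:A * eps (a + a').
  by rewrite alg_mpolyC thP /eps -!mulmxE -!scalar_mxM -!polyCM eM.
have epsC a q : eps a * th q = th q * eps a by apply/comm_scalar_mx.
pose T (y : tw D {mpoly k[n]}) := tw_ev th eps y.
have [T1 TM] : T 1 = 1 /\ {morph T : y z / y * z}.
  by have [] := tw_ev_is_monoid_morphism eps0 epsM epsC.
have TI q : T (tw_inc D q) = th q by apply: tw_ev_inc.
pose H y := \det (T y).
have HM : {morph H : y z / y * z} by move=> y z; rewrite /H TM det_mulmx.
have H1 : H 1 = 1 by rewrite /H T1 det1.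
have Hact g y : H (tw_act g y) = map_poly (gam g) (H y).
  rewrite /H -det_map_mx; congr (\det _); rewrite /T /tw_ev raddf_sum.
  apply: eq_bigr => a _; rewrite ffunE thZ.
  transitivity (th (y a) *m ((kap (kch g a))%:P%:M *m eps a)).
    by rewrite mulmxA; congr (_ *m _); apply/esym/scalar_mxC.
  apply/esym; rewrite /= -mulmxE map_mxM map_scalar_mx /= map_polyC /= gam_e.
  rewrite polyCM scalar_mxM; congr (_ *m _).
  apply/matrixP => a1 a2; rewrite !mxE; apply/polyP => l.
  by rewrite !coef_map /= gam_G.
have HN y : gam_norm gam (H y) = H (tw_inc D (tw_norm y)).
  rewrite tw_normE (big_morph H HM H1).
  by apply: eq_bigr => g _; rewrite Hact.
have Hnorm : gam_norm gam (H V) = gam_norm gam (H (tw_inc D b)).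
  by rewrite !HN normV tw_norm_inc.
have ev t y : (H y).[t] = \det (\sum_a map_mx (horner_eval t) (th (y a)) *m (e a)%:M).
  rewrite -[LHS]/(horner_eval t _) -det_map_mx; congr (\det _); rewrite raddf_sum.
  apply: eq_bigr => a _; rewrite /= map_mxM map_scalar_mx; congr (_ *m _%:M).
  by rewrite /= /horner_eval hornerC.
have Gev (t : F) q :
    map_mx (horner_eval (G t)) (th q) = map_mx G (map_mx (horner_eval t) (theta q)).
  by apply/matrixP => a a'; rewrite !mxE /horner_eval horner_map.
have th0' q : map_mx (horner_eval 0) (th q) = map_mx G (rho (mmap j s q)).
  by rewrite -th0 -Gev rmorph0.
have th1' q : map_mx (horner_eval 1) (th q) = (kap q.@[v])%:M.
  by rewrite -[1 in LHS](rmorph1 G) Gev th1 map_scalar_mx /= G_i.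
pose B := mmap j s b.
(* A common factor of both values at 0; it cancels, being the determinant of an invertible
   matrix. *)
pose dB := \det (map_mx G (rho B)).
have dB0 : dB != 0.
  suff : dB * \det (map_mx G (rho B^-1)) != 0 by rewrite mulf_eq0 negb_or => /andP[].
  rewrite /dB -det_mulmx -map_mxM -[_ *m _]rmorphM divff // rmorph1.
  by rewrite map_mx1 det1 oner_neq0.
set z := \sum_a G (x a) * e a; set w := \sum_a _.
have V0 : (H V).[0] = dB * z ^+ d.+1.
  rewrite ev -det_scalar -det_mulmx; congr (\det _).
  have -> : z%:M = \sum_a (G (x a) * e a)%:M :> 'M_d.+1 by rewrite /z raddf_sum.
  rewrite mulmx_sumr; apply: eq_bigr => a _ /=.
  by rewrite th0' sV map_mxM map_scalar_mx -mulmxA -scalar_mxM.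
have b0 : (H (tw_inc D b)).[0] = dB.
  by rewrite -[LHS]/(horner_eval 0 _) /H TI -det_map_mx th0'.
have V1 : (H V).[1] = w ^+ d.+1.
  rewrite ev -det_scalar; congr (\det _); rewrite /w raddf_sum.
  by apply: eq_bigr => a _ /=; rewrite th1' -scalar_mxM.
have b1 : (H (tw_inc D b)).[1] = (kap b.@[v]) ^+ d.+1.
  by rewrite -[LHS]/(horner_eval 1 _) /H TI -det_map_mx th1' det_scalar.
have HV0 : H V != 0.
  have : gam_norm gam (H (tw_inc D b)) != 0.
    by apply: gam_norm_neq0; apply: contraNneq dB0 => hb; rewrite -b0 hb horner0.
  rewrite -Hnorm; apply: contraNneq => ->.
  by rewrite /gam_norm (bigD1 0) //= rmorph0 mul0r.
have := gam_norm_eq gamD gam0 muM mu_gam (fun g => rmorph0 (gam g))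
  (fun g => rmorph1 (gam g)) HV0 Hnorm.
rewrite V0 V1 b0 b1 muM !muX [RHS]mulrC -mulrA.
by apply: mulfI; rewrite mu_eq0.
Qed.

End Detector.

Lemma div_exp_widen (F : fieldType) (u z : F) (m n : nat) :
  z != 0 -> (n <= m)%N -> u / z ^+ n = u * z ^+ (m - n) / z ^+ m.
Proof.
move=> z0 nm; apply/eqP.
by rewrite eqr_div ?expf_neq0 // -mulrA -exprD subnK.
Qed.

Section Obstruction.

Variables (k E C : fieldType) (D : kummer k) (em : {rmorphism gfun D -> E}).
Variables (e : kidx D -> E) (gam : kidx D -> {rmorphism E -> E}) (mu : E -> C).

Let kap : {rmorphism k -> E} := em \o in_alg (gfun D).

Hypothesis e0 : e 0 = 1.
Hypothesis eM : forall a b, e a * e b = kap (kcoc a b) * e (a + b).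
Hypothesis gam_e : forall g a, gam g (e a) = kap (kch g a) * e a.
Hypothesis gam_em : forall g x, gam g (em x) = em x.
Hypothesis gamD : forall g h x, gam (g + h) x = gam g (gam h x).
Hypothesis gam0 : forall x, gam 0 x = x.
Hypothesis muM : {morph mu : x y / x * y}.
Hypothesis mu_eq0 : forall x, (mu x == 0) = (x == 0).
Hypothesis mu_gam : forall g x, mu (gam g x) = mu x.

Local Notation ev := (tw_ev em e).

Lemma em_scale c y : em (c *: y) = kap c * em y.
Proof. by rewrite -mulr_algl rmorphM. Qed.

Lemma ev_gam g x : gam g (ev x) = ev (tw_act g x).
Proof.
rewrite /tw_ev raddf_sum; apply: eq_bigr => a _ /=.
by rewrite rmorphM gam_em gam_e ffunE em_scale mulrCA mulrA.
Qed.

Lemma ev_monoid : monoid_morphism ev.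
Proof. by apply: tw_ev_is_monoid_morphism => // a r; apply: mulrC. Qed.

(** If the value is 0, so are its conjugates, from which orthogonality of characters extracts each
    coordinate of x. The Kummer algebra over the function field thus embeds in the field E. *)
Lemma ev_eq0 x : ev x = 0 -> x = 0.
Proof.
move=> x0; apply/ffunP => b; rewrite ffunE.
have eb0 : e b != 0.
  have : e b * e (- b) != 0.
    by rewrite eM subrr e0 mulr1 fmorph_eq0 kcoc_neq0.
  by rewrite mulf_eq0 negb_or => /andP[].
have : \sum_g kap (kch g (- b)) * ev (tw_act g x) = 0.
  by apply: big1 => g _; rewrite -ev_gam x0 rmorph0 mulr0.
have -> : \sum_g kap (kch g (- b)) * ev (tw_act g x) =
    \sum_a kap (\sum_g kch (a - b) g) * (em (x a) * e a).
  transitivity (\sum_g \sum_a kap (kch (a - b) g) * (em (x a) * e a)).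
    apply: eq_bigr => g _; rewrite mulr_sumr; apply: eq_bigr => a _.
    by rewrite ffunE em_scale !mulrA -rmorphM -kchD addrC kchC.
  rewrite exchange_big; apply: eq_bigr => a _.
  by rewrite -mulr_suml (rmorph_sum kap).
rewrite (bigD1 b) //= [X in _ + X]big1 ?addr0 => [|a /negbTE ab]; last first.
  by rewrite sum_kch subr_eq0 ab mul0r scale0r rmorph0 mul0r.
rewrite sum_kch subrr eqxx mul1r => /eqP; rewrite !mulf_eq0 (negbTE eb0) orbF.
rewrite fmorph_eq0 scaler_eq0 oner_eq0 orbF (negbTE (kcard_neq0 D)) /=.
by rewrite fmorph_eq0 => /eqP.
Qed.

Lemma tw_gfun_integral : GRing.integral_domain_axiom (tw D (gfun D)).
Proof.
move=> x y xy; have : ev x * ev y = 0.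
  by rewrite -ev_monoid.2 xy /tw_ev big1 // => a _; rewrite ffunE rmorph0 mul0r.
move/eqP; rewrite mulf_eq0 => /orP[] /eqP/ev_eq0 ->; rewrite eqxx ?orbT //.
Qed.

Lemma ev_gpt_neq0 : ev (gpt D) != 0.
Proof.
have : ev (gpt D) * ev (tw_cof (gpt D)) != 0.
  by rewrite -ev_monoid.2 tw_mul_cof tw_norm_gpt rmorph1 ev_monoid.1 oner_neq0.
by rewrite mulf_eq0 negb_or => /andP[].
Qed.

Section Scaling.

Variables (om : k) (om1 : om ^+ #|kidx D| = 1).

Let om0 : om != 0.
Proof.
have N0 : #|kidx D| != 0%N by apply: contraNneq (kcard_neq0 D) => ->.
by apply/eqP => o0; move/eqP: om1; rewrite o0 expr0n (negbTE N0) eq_sym oner_eq0.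
Qed.

Lemma scale_norm (c : k) (R : comAlgType k) (x : tw D R) :
  c ^+ #|kidx D| = 1 -> tw_norm x = 1 -> tw_norm (c *: x) = 1.
Proof.
move=> c1 x1; rewrite -mulr_algl tw_normM x1 mulr1 -(rmorph_alg (@tw_inc k D R)).
by rewrite tw_norm_inc exprZn c1 expr1n scale1r.
Qed.

(** If P vanishes at [om *: gpt D], then P(om y) vanishes at the generic point, hence at its
    translate by the inverse of [om], where it equals P at [gpt D]. *)
Lemma norm1_hom_scale_inj (x1 : tw_norm (om *: gpt D) = 1) : injective (norm1_hom x1).
Proof.
apply: raddf_inj => u; case: (tcoordP u) => P ->.
move=> uP0; have P0 : poly_at (om *: gpt D) P = 0 by rewrite -(norm1_funE x1).
pose P' := mpoly_eval (fun i => om *: 'X_i : {mpoly k[#|kidx D|]}) P.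
have P'E (y : tw D (gfun D)) : poly_at y P' = poly_at (om *: y) P.
  rewrite /P' mpoly_eval_comp; apply: mpoly_lrmorph_ext (P) => i.
  by rewrite poly_atX mpoly_evalX linearZ /= poly_atX ffunE.
have P'0 : poly_at (gpt D) P' = 0 by rewrite P'E.
apply: (@tcoord_inc_inj _ D); rewrite poly_at_univ rmorph0.
rewrite -[gpt D](scalerK om0) scalerA mulrC -scalerA -P'E.
apply: gpt_generic P'0 _; apply: scale_norm; last exact: tw_norm_gpt.
by rewrite exprVn om1 invr1.
Qed.

End Scaling.

Hypothesis char0 : forall m, m.+1%:R != 0 :> k.

(** The generic point and its translate by [om] both embed the function field of the torus in E. For
    both, [detector_eq] has the same right-hand side, fixed by [V] and [v], so [mu (kap om)] to the
    power of the degree is 1. *)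
Lemma norm1_not_retract (p : nat) (om : k) :
    om ^+ #|kidx D| = 1 ->
    (forall d, ~~ (p %| d)%N -> mu (kap om) ^+ d != 1) ->
  ~ p_retract_rational p (norm1_var D).
Proof.
move=> om1 omd [n [X' [f [d [s [pi]]]]]] [[_ _ [phi [phiE [bas basP]]] pd]].
case=> -[Q [P [sQP [g gP gE]]]] ceq.
(* Degree 0 is excluded because p divides 0. *)
case: d => [|d] in bas basP pd *; first by rewrite dvdn0 in pd.
have sg0 : s g != 0.
  by apply: contraNneq gP => sg; rewrite sQP sg idealr0.
pose mm a := sval (cid (gE (univ D a))).
pose uu a : {mpoly k[n]} := sval (cid (svalP (cid (gE (univ D a))))).
have piE a : pi (univ D a) = (uu a : coord (affine_space k n))%:F / (g ^+ mm a)%:F.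
  exact: (svalP (cid (svalP (cid (gE (univ D a)))))).
pose g1 : {mpoly k[n]} := g.
have g0 : torat g1 != 0.
  by rewrite torat_eq0; apply: contraNneq sg0 => g10; rewrite [g]g10 rmorph0.
have {}piE a : pi (univ D a) = torat (uu a) / torat g1 ^+ mm a.
  by rewrite -rmorphXn; exact: piE.
(* This exponent bounds every [mm a], so [b] is a common denominator of the coordinates of [pi]. *)
pose m := (\sum_a mm a)%N.
pose b := g1 ^+ m.
pose V : tw D {mpoly k[n]} := [ffun a => uu a * g1 ^+ (m - mm a)].
have b0 : torat b != 0 by rewrite rmorphXn expf_neq0.
have piV a : pi (univ D a) = torat (V a) / torat b.
  have mam : (mm a <= m)%N by rewrite /m (bigD1 a) //= leq_addr.
  by rewrite piE ffunE rmorphM !rmorphXn /= (div_exp_widen _ g0 mam).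
have pi_scal : scalable (pi : tcoord D -> ratfun k n).
  move=> c u; rewrite -mulr_algl rmorphM; case: {+}pi => pi' /= ->.
  by rewrite /GRing.scale /= /ratfun_scale -alg_mpolyC.
pose piL : {lrmorphism tcoord D -> ratfun k n} := HB.pack (pi : tcoord D -> ratfun k n)
  (GRing.isZmodMorphism.Build (tcoord D) (ratfun k n) pi (raddfB pi))
  (GRing.isMonoidMorphism.Build (tcoord D) (ratfun k n) pi (rmorph1 pi, rmorphM pi))
  (GRing.isScalable.Build k (tcoord D) (ratfun k n) *:%R pi pi_scal).
have normV : tw_norm V = b ^+ #|kidx D|.
  have : tw_norm (tw_map piL (univ D)) = 1 by rewrite -tw_map_norm tw_norm_univ rmorph1.
  have -> : tw_map piL (univ D) = tw_inc D (torat b)^-1 * tw_map (@torat k n) V.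
    by apply/ffunP => a; rewrite tw_incM ffunE [RHS]mulrC [in RHS]ffunE -piV.
  rewrite tw_normM tw_norm_inc -tw_map_norm exprVn => e1; apply: torat_inj.
  have bN : torat b ^+ #|kidx D| != 0 by rewrite expf_neq0.
  by rewrite -[LHS](mulVKf bN) e1 mulr1 [RHS]rmorphXn.
have sb0 : s b != 0 by rewrite rmorphXn expf_neq0.
have sV a : (s (V a))%:F = (s b)%:F * (f (univ D a))%:F.
  by rewrite -(ceq (univ D a) (V a) b) // mulrCA divff ?mulr1 // tofrac_eq0.
have [rho rhoE] := regular_representation basP.
pose j : {rmorphism k -> {fraction coord X'}} := @tofrac (coord X') \o in_alg (coord X').
pose i : {rmorphism k -> {fraction coord (norm1_var D)}} :=
  @tofrac (coord (norm1_var D)) \o in_alg (coord (norm1_var D)).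
have rho_j c : rho (j c) = (i c)%:M.
  by rewrite /j /= -(rmorph_alg f) -phiE rhoE.
pose s' l := (s 'X_l)%:F.
have s'E q : mmap j s' q = (s q)%:F.
  elim/mpoly_ringind: q => [c|l|q r eq er|q r eq er].
  - by rewrite mmapC -alg_mpolyC rmorph_alg.
  - by rewrite mmapX mmap1U.
  - by rewrite !rmorphD /= eq er.
  - by rewrite !rmorphM /= eq er.
pose x a := (univ D a : coord (norm1_var D))%:F.
have sb1 : mmap j s' b != 0 by rewrite s'E tofrac_eq0.
have rhoV a : rho (mmap j s' (V a)) = rho (mmap j s' b) * (x a)%:M.
  by rewrite !s'E sV rmorphM -phiE rhoE.
have bn0 : b != 0 by rewrite -torat_eq0.
(* The constant end of the line: a k-point off the zeros of the denominator. *)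
have [v bv] := mpoly_nonroot char0 bn0.
have main y (y1 : tw_norm y = 1) : injective (norm1_hom y1) ->
    mu (ev y) ^+ d.+1 * mu (kap b.@[v]) ^+ d.+1 =
    mu (\sum_a kap (V a).@[v] * e a) ^+ d.+1.
  move=> inj.
  have em_inj : injective (em \o norm1_hom y1) by apply: inj_comp inj; apply: fmorph_inj.
  pose h : {rmorphism coord (norm1_var D) -> E} := em \o norm1_hom y1.
  pose G := frac_rmorph (h := h) em_inj.
  have GE u : G u%:F = em (norm1_hom y1 u) by apply: frac_rmorphE.
  have <- : \sum_a G (x a) * e a = ev y.
    apply: eq_bigr => a _; rewrite GE -[in RHS](norm1_hom_univ y1).
    by rewrite [in RHS]ffunE.
  apply: (detector_eq e0 eM gam_e gamD gam0 muM mu_eq0 mu_gam rho_j _ _ normV sb1 rhoV bv).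
    by move=> c; rewrite GE rmorph_alg.
  move=> g' z; case: (fracP z) => -[z1 z2] _ ->.
  by rewrite /= !fmorph_div !GE !gam_em.
have om1n : tw_norm (om *: gpt D) = 1 by apply: scale_norm om1 (tw_norm_gpt D).
have om1' : tw_norm ((1 : k) *: gpt D) = 1 by rewrite scale1r tw_norm_gpt.
have E1 := main _ _ (norm1_hom_scale_inj om1 (x1 := om1n)).
have E2 := main _ _ (norm1_hom_scale_inj (expr1n _ _) (x1 := om1')).
have evZ c : ev (c *: gpt D) = kap c * ev (gpt D).
  by rewrite /tw_ev mulr_sumr; apply: eq_bigr => a _; rewrite ffunE em_scale mulrA.
have mun0 c : c != 0 -> mu c ^+ d.+1 != 0 by move=> c0; rewrite expf_neq0 ?mu_eq0.
have kb0 : kap b.@[v] != 0 by rewrite fmorph_eq0.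
have E3 : mu (ev (om *: gpt D)) ^+ d.+1 = mu (ev (1 *: gpt D)) ^+ d.+1.
  by apply: (mulIf (mun0 _ kb0)); rewrite E1 E2.
have /negP := omd _ pd; apply; apply/eqP/(mulIf (mun0 _ ev_gpt_neq0)).
by rewrite mul1r -exprMn -muM -evZ E3 scale1r.
Qed.

End Obstruction.

(** * The bicyclic Kummer extension of the field of fractions in two variables *)

Section LeadingCoefficient.

Variables (n : nat) (F : fieldType).
Implicit Types p q : {mpoly F[n]}.

Lemma mleadc_mul p q : mleadc (p * q) = mleadc p * mleadc q.
Proof.
have [->|p0] := eqVneq p 0; first by rewrite mul0r !mcoeff0 mul0r.
have [->|q0] := eqVneq q 0; first by rewrite mulr0 !mcoeff0 mulr0.
by rewrite mleadM // mleadcM.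
Qed.

(** Such a change of coefficients keeps the support, hence the leading monomial. It covers the
    scaling of s and t by G and the action of automorphisms on coefficients. *)
Lemma mleadc_twist p q (f : 'X_{1..n} -> F -> F) :
    (forall m, q@_m = f m p@_m) -> (forall m c, (f m c == 0) = (c == 0)) ->
  mleadc q = f (mlead p) (mleadc p).
Proof.
move=> qp f0.
have suppE m : (m \in msupp q) = (m \in msupp p) by rewrite !mcoeff_msupp qp f0.
have [p0|p0] := eqVneq p 0.
  have -> : q = 0.
    apply/mpolyP => m; apply/eqP; rewrite mcoeff0 qp f0 p0 mcoeff0.
    exact: eqxx.
  by apply/eqP; rewrite eq_sym p0 !mcoeff0 f0.
have q0 : q != 0.
  apply/eqP => q0; have := mlead_supp p0.
  by rewrite -suppE mcoeff_msupp q0 mcoeff0 eqxx.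
suff -> : mlead q = mlead p by rewrite qp.
apply: Order.POrderTheory.le_anti.
apply/andP; split; apply: msupp_le_mlead.
  by rewrite -suppE mlead_supp.
by rewrite suppE mlead_supp.
Qed.

Definition lc : {fraction {mpoly F[n]}} -> F := frac_lift (fun p => mleadc p).

Lemma lc_div p q : q != 0 -> lc (p%:F / q%:F) = mleadc p / mleadc q.
Proof. by apply: frac_lift_div => [x y|x]; rewrite ?mleadc_mul ?mleadc_eq0. Qed.

Lemma lcM : {morph lc : x y / x * y}.
Proof. by apply: frac_lift_mul => [x y|x]; rewrite ?mleadc_mul ?mleadc_eq0. Qed.

Lemma lc_eq0 x : (lc x == 0) = (x == 0).
Proof. by apply: frac_lift_eq0 => [p q|p]; rewrite ?mleadc_mul ?mleadc_eq0. Qed.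

Lemma lcC c : lc (c%:MP : {mpoly F[n]})%:F = c.
Proof.
rewrite /lc frac_lift_tofrac ?mleadcC // => [x y|x]; first exact: mleadc_mul.
by rewrite mleadc_eq0.
Qed.

End LeadingCoefficient.

(** * The fixed field of a finite group and its separable closure *)

Section FixedField.

Variables (I : finZmodType) (K : fieldType) (gam : I -> {rmorphism K -> K}).

Definition fixed_pred : {pred K} := fun x => [forall g, gam g x == x].

Fact fixed_predP x : reflect (forall g, gam g x = x) (x \in fixed_pred).
Proof. exact: 'forall_eqP. Qed.

Fact fixed_divring_closed : GRing.divring_closed fixed_pred.
Proof.
split=> [|x y /fixed_predP fx /fixed_predP fy|x y /fixed_predP fx /fixed_predP fy].
- by apply/fixed_predP => g; rewrite rmorph1.
- by apply/fixed_predP => g; rewrite rmorphB fx fy.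
- by apply/fixed_predP => g; rewrite fmorph_div fx fy.
Qed.

HB.instance Definition _ := GRing.isDivringClosed.Build K fixed_pred fixed_divring_closed.

Record fixfield := FixField { fixfield_val :> K; _ : fixfield_val \in fixed_pred }.

HB.instance Definition _ := [isSub for fixfield_val].
HB.instance Definition _ := [Choice of fixfield by <:].
HB.instance Definition _ := [SubChoice_isSubUnitRing of fixfield by <:].
HB.instance Definition _ := [SubNzRing_isSubComNzRing of fixfield by <:].
HB.instance Definition _ := [SubComUnitRing_isSubIntegralDomain of fixfield by <:].
HB.instance Definition _ := [SubIntegralDomain_isSubField of fixfield by <:].

Definition fixfield_inc (x : fixfield) : K := fixfield_val x.

Fact fixfield_inc_is_zmod_morphism : zmod_morphism fixfield_inc.
Proof. by []. Qed.

Fact fixfield_inc_is_monoid_morphism : monoid_morphism fixfield_inc.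
Proof. by []. Qed.

HB.instance Definition _ := GRing.isZmodMorphism.Build fixfield K
  fixfield_inc fixfield_inc_is_zmod_morphism.
HB.instance Definition _ := GRing.isMonoidMorphism.Build fixfield K
  fixfield_inc fixfield_inc_is_monoid_morphism.

Lemma fixfield_incP x : gam^~ (fixfield_inc x) =1 fun=> fixfield_inc x.
Proof. by move=> g; apply/fixed_predP: g; apply: valP. Qed.

Hypothesis gamD : forall g h x, gam (g + h) x = gam g (gam h x).
Hypothesis gam0 : forall x, gam 0 x = x.
Hypothesis char0 : forall m, m.+1%:R != 0 :> fixfield.

Variables (L : closedFieldType) (io : {rmorphism K -> L}).
Hypothesis io_integral : integralRange io.

(** The product of the conjugates of an equation over K has invariant coefficients. *)
Lemma fixfield_algebraic (x : L) :
  exists2 q : {poly fixfield}, q != 0 & root (map_poly (io \o fixfield_inc) q) x.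
Proof.
have [p mp px] := io_integral x.
have [q qE] : exists q : {poly fixfield}, map_poly fixfield_inc q = gam_norm gam p.
  have coefF i : (gam_norm gam p)`_i \in fixed_pred.
    apply/fixed_predP => g; rewrite -coef_map.
    suff -> : map_poly (gam g) (gam_norm gam p) = gam_norm gam p by [].
    rewrite /gam_norm rmorph_prod [RHS](reindex_inj (addrI g)) /=.
    by apply: eq_bigr => h _; rewrite GamD.
  exists (\poly_(i < size (gam_norm gam p)) FixField (coefF i)).
  apply/polyP => i; rewrite coef_map coef_poly; case: ltnP => [//|le_i].
  by rewrite [RHS]nth_default.
have p0 := monic_neq0 mp.
exists q.
  by apply: contraNneq (gam_norm_neq0 gam p0) => q0; rewrite -qE q0 rmorph0.
rewrite map_poly_comp qE /gam_norm (bigD1 0) //= rmorphM rootM.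
by rewrite Gam0 // px.
Qed.

(** In characteristic 0 an equation q of least size for x is separable: otherwise x would be a root
    of the gcd of q and its derivative, or of the cofactor, both smaller than q. *)
Lemma fixfield_separable_closure :
  separable_closure (io \o fixfield_inc : {rmorphism fixfield -> L}).
Proof.
split=> [x|q _ q1]; last by apply/closed_rootP.
pose P (n : nat) := `[< exists q : {poly fixfield}, [/\ q != 0, size q = n &
  root (map_poly (io \o fixfield_inc) q) x] >].
have exP : exists n, P n.
  by have [q q0 qx] := fixfield_algebraic x; exists (size q); apply/asboolP; exists q.
have [n /asboolP[q [q0 qn qx]] minn] := ex_minnP exP.
have qmin r : r != 0 -> root (map_poly (io \o fixfield_inc) r) x -> (size q <= size r)%N.
  by move=> r0 rx; rewrite qn; apply: minn; apply/asboolP; exists r.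
exists q; split=> //; rewrite separable_poly.unlock /coprimep; apply/negPn/negP => g1.
have q1 : (1 < size q)%N.
  rewrite ltnNge; apply/negP => /size1_polyC qE; move: qx q0; rewrite qE.
  by rewrite map_polyC rootC fmorph_eq0 polyC_eq0 => ->.
have dq0 : q^`() != 0.
  apply/eqP => /polyP/(_ (size q).-2); rewrite coef_deriv coef0.
  have := lead_coef_eq0 q; rewrite (negbTE q0) lead_coefE.
  case: (size q) q1 => [|[|j]] //= _ qj /eqP.
  by rewrite -mulr_natr mulf_eq0 qj (negbTE (char0 j)).
have g0 : gcdp q q^`() != 0 by rewrite gcdp_eq0 negb_and q0.
have gs : (size (gcdp q q^`()) < size q)%N.
  by apply: leq_ltn_trans (dvdp_leq dq0 (dvdp_gcdr _ _)) (lt_size_deriv q0).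
have /dvdpP[r rE] := dvdp_gcdl q q^`().
have r0 : r != 0 by apply: contraNneq q0 => r0; rewrite rE r0 mul0r.
move: (qx); rewrite {1}rE rmorphM rootM => /orP[/(qmin _ r0)|/(qmin _ g0)]; last first.
  by rewrite leqNgt gs.
rewrite [in size q]rE size_mul // leqNgt => /negP; apply.
move: g1 g0; rewrite -size_poly_gt0; case: (size (gcdp _ _)) => [|[|s]] // _ _.
by rewrite !addnS /= ltnS leq_addr.
Qed.

End FixedField.

(** Ordinals add modulo n = [m.+1], and their values serve as exponents of s and t. *)
Definition wgrp (m : nat) : Type := {ffun 'I_2 -> 'I_m.+1}.

HB.instance Definition _ m := GRing.Zmodule.on (wgrp m).
HB.instance Definition _ m := Finite.on (wgrp m).

Section KummerField.

Variables (m : nat) (z : algC).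
Hypothesis hz : m.+1.-primitive_root z.

Local Notation I := (wgrp m).
Implicit Types (g h a b : I) (u v : 'X_{1..2}).

(** The scalar by which g multiplies the monomial of exponent u. *)
Definition wt g u : algC := z ^+ (\sum_i g i * u i)%N.

Lemma z_neq0 : z != 0.
Proof.
apply/eqP => z0; have /eqP := prim_expr_order hz.
by rewrite z0 expr0n eq_sym oner_eq0.
Qed.

Lemma wt_neq0 g u : wt g u != 0.
Proof. by rewrite expf_neq0 ?z_neq0. Qed.

Lemma wt_prod g u : wt g u = \prod_i (z ^+ g i) ^+ u i.
Proof. by rewrite /wt -prodrXr; apply: eq_bigr => i _; rewrite exprM. Qed.

Lemma wtD g h u : wt (g + h) u = wt g u * wt h u.
Proof.
rewrite !wt_prod -big_split; apply: eq_bigr => i _ /=.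
by rewrite ffunE /= prim_expr_mod // exprD exprMn.
Qed.

Lemma wt0 u : wt 0 u = 1.
Proof. by rewrite wt_prod big1 // => i _; rewrite ffunE expr0 expr1n. Qed.

Lemma wt_exp g u : wt g u ^+ m.+1 = 1.
Proof. by rewrite /wt exprAC (prim_expr_order hz) expr1n. Qed.

Definition wact g : {lrmorphism {mpoly algC[2]} -> {mpoly algC[2]}} :=
  mpoly_eval (fun i => z ^+ g i *: 'X_i).

Lemma wactX g u : wact g 'X_[u] = wt g u *: 'X_[u].
Proof.
rewrite mpolyXE_id rmorph_prod wt_prod -scaler_prod; apply: eq_bigr => i _ /=.
by rewrite rmorphXn /= mpoly_evalX exprZn.
Qed.

Lemma wact_coef g p u : (wact g p)@_u = wt g u * p@_u.
Proof.
elim/mpolyind: p => [|c v p _ _ IHp]; first by rewrite rmorph0 mcoeff0 mulr0.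
rewrite rmorphD /= linearZ /= wactX !mcoeffD IHp mulrDr; congr (_ + _).
rewrite !mcoeffZ mcoeffX; have [->|_] := eqVneq v u; last by rewrite !mulr0.
by rewrite !mulr1 mulrC.
Qed.

Lemma wact_inj g : injective (wact g).
Proof.
move=> p q pq; apply/mpolyP => u; apply: (mulfI (wt_neq0 g u)).
by rewrite -!wact_coef pq.
Qed.

Definition kfun := {fraction {mpoly algC[2]}}.

Fact tofrac_wact_inj g : injective ((@tofrac {mpoly algC[2]}) \o wact g).
Proof.
by apply: inj_comp (@wact_inj g) => p q /eqP; rewrite tofrac_eq => /eqP.
Qed.

Definition gamK g : {rmorphism kfun -> kfun} :=
  frac_rmorph (h := (@tofrac {mpoly algC[2]}) \o wact g) (@tofrac_wact_inj g).

Lemma gamKE g p : gamK g p%:F = (wact g p)%:F.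
Proof. exact: frac_rmorphE. Qed.

Lemma gamKD g h x : gamK (g + h) x = gamK g (gamK h x).
Proof.
apply: (frac_rmorph_ext (g' := gamK g \o gamK h)) => p /=; rewrite !gamKE.
by congr (_ %:F); apply/mpolyP => u; rewrite !wact_coef wtD mulrA.
Qed.

Lemma gamK0 x : gamK 0 x = x.
Proof.
apply: (frac_rmorph_ext (g' := idfun)) => p /=; rewrite gamKE.
by congr (_ %:F); apply/mpolyP => u; rewrite wact_coef wt0 mul1r.
Qed.

Definition kcst (c : algC) : kfun := (c%:MP : {mpoly algC[2]})%:F.

HB.instance Definition _ :=
  GRing.RMorphism.copy kcst ((@tofrac {mpoly algC[2]}) \o (@mpolyC 2 algC)).

Lemma gamK_cst g c : gamK g (kcst c) = kcst c.
Proof. by rewrite gamKE -alg_mpolyC rmorph_alg alg_mpolyC. Qed.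

Definition base := fixfield gamK.

Definition bcst (c : algC) : base :=
  @FixField _ _ gamK (kcst c) (introT (fixed_predP _ _) (gamK_cst^~ c)).

Lemma base_char0 j : j.+1%:R != 0 :> base.
Proof.
apply/eqP => /(congr1 (@fixfield_inc _ _ gamK))/eqP.
rewrite rmorph_nat rmorph0 -(rmorph_nat kcst) fmorph_eq0.
by rewrite Num.Theory.pnatr_eq0.
Qed.

Definition wmon a : 'X_{1..2} := [multinom (a i : nat) | i < 2].

(** The Kummer basis of K. Exponents are reduced modulo n when indices are added, which makes the
    cocycle [bcoc] nontrivial. *)
Definition kmon a : kfun := ('X_[wmon a] : {mpoly algC[2]})%:F.

Lemma wt_monC a b : wt a (wmon b) = wt b (wmon a).
Proof. by congr (z ^+ _); apply: eq_bigr => i _; rewrite !mnmE mulnC. Qed.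

Lemma kmon_neq0 a : kmon a != 0.
Proof.
rewrite tofrac_eq0; apply/eqP => /mpolyP/(_ (wmon a))/eqP.
by rewrite mcoeffX eqxx mcoeff0 oner_eq0.
Qed.

Lemma kmon0 : kmon 0 = 1.
Proof.
rewrite /kmon (_ : wmon 0 = 0%MM) ?mpolyX0 ?rmorph1 //.
by apply/mnmP => i; rewrite mnmE ffunE mnm0E.
Qed.

Lemma gamK_mon g a : gamK g (kmon a) = kcst (wt g (wmon a)) * kmon a.
Proof. by rewrite gamKE wactX -mul_mpolyC rmorphM. Qed.

Fact coc_fixed a b : kmon a * kmon b / kmon (a + b) \in fixed_pred gamK.
Proof.
apply/fixed_predP => g; rewrite fmorph_div rmorphM !gamK_mon.
have -> : wt g (wmon (a + b)) = wt g (wmon a) * wt g (wmon b).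
  by rewrite !(wt_monC g) wtD.
rewrite rmorphM mulrACA -mulf_div divff ?mul1r //.
by rewrite mulf_neq0 // fmorph_eq0 wt_neq0.
Qed.

Definition bcoc a b : base := FixField (coc_fixed a b).

Definition bch a b : base := bcst (wt a (wmon b)).

Lemma bcocE a b : kmon a * kmon b = fixfield_inc (bcoc a b) * kmon (a + b).
Proof. by rewrite /= divfK ?kmon_neq0. Qed.

Fact bcocC a b : bcoc a b = bcoc b a.
Proof. by apply: val_inj; rewrite /= addrC [kmon a * _]mulrC. Qed.

Fact bcoc0 a : bcoc 0 a = 1.
Proof. by apply: val_inj; rewrite /= add0r kmon0 mul1r divff ?kmon_neq0. Qed.

Fact bcocA a b d : bcoc a b * bcoc (a + b) d = bcoc a (b + d) * bcoc b d.
Proof.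
pose inc : {rmorphism base -> kfun} := @fixfield_inc _ _ gamK.
have incE a' b' : inc (bcoc a' b') = kmon a' * kmon b' / kmon (a' + b') by [].
suff : inc (bcoc a b * bcoc (a + b) d) = inc (bcoc a (b + d) * bcoc b d).
  exact: val_inj.
rewrite !rmorphM !incE; apply: (mulIf (kmon_neq0 (a + b + d))).
transitivity (kmon a * kmon b * kmon d).
  by rewrite -[LHS]mulrA divfK ?kmon_neq0 // [LHS]mulrA divfK ?kmon_neq0.
rewrite [RHS]mulrAC -addrA divfK ?kmon_neq0 // -[RHS]mulrA.
by rewrite [kmon (b + d) * _]mulrC divfK ?kmon_neq0 // mulrA.
Qed.

Fact bcoc_neq0 a b : bcoc a b != 0.
Proof.
rewrite -(inj_eq val_inj) /=.
by rewrite !mulf_neq0 ?invr_eq0 ?kmon_neq0.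
Qed.

Fact bchC a b : bch a b = bch b a.
Proof. by apply: val_inj; rewrite /= wt_monC. Qed.

Fact bch0 a : bch a 0 = 1.
Proof. by apply: val_inj; rewrite /= wt_monC wt0 [kcst _]rmorph1. Qed.

Fact bchD a b d : bch a (b + d) = bch a b * bch a d.
Proof.
by apply: val_inj; rewrite /= wt_monC wtD [kcst _]rmorphM /= -!(wt_monC a).
Qed.

Lemma kcst_inj : injective kcst.
Proof. exact: fmorph_inj. Qed.

Fact bch_nondeg a : a != 0 -> exists b, bch a b != 1.
Proof.
move=> a0; have [i ai] : exists i, a i != 0.
  apply/existsP; apply: contraNT a0 => /existsPn h; apply/eqP/ffunP => i.
  by rewrite ffunE; apply/eqP; have := h i; rewrite negbK.
pose b : I := [ffun j => if j == i then inord 1 else 0].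
exists b; apply/eqP => /(congr1 (@fixfield_inc _ _ gamK)).
rewrite rmorph1 -(rmorph1 kcst) => /kcst_inj/eqP.
(* For m = 0 the value [inord 1] would be 0, but then no [a i] is nonzero. *)
have m0 : (0 < m)%N.
  rewrite lt0n; apply: contraNneq ai => m0; apply/eqP/val_inj/eqP => /=.
  by have := ltn_ord (a i); rewrite ltnS [X in (_ <= X)%N]m0 leqn0.
rewrite /wt (bigD1 i) //= big1 => [|j ji]; last first.
  by rewrite mnmE ffunE (negbTE ji) muln0.
rewrite mnmE ffunE eqxx inordK // muln1 addn0 -(prim_order_dvd hz) => dv.
have := dvdn_leq _ dv; rewrite lt0n -val_eqE /= in ai *.
by rewrite leqNgt ltn_ord => /(_ ai).
Qed.

Lemma card_wgrp : #|{: I}| = (m.+1 ^ 2)%N.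
Proof. by rewrite card_ffun !card_ord. Qed.

Fact card_wgrp_neq0 : #|{: I}|%:R != 0 :> base.
Proof.
by rewrite card_wgrp -(prednK (_ : 0 < m.+1 ^ 2)%N) ?expn_gt0 // base_char0.
Qed.

Definition kummer_datum : kummer base := Kummer bcocC bcoc0 bcocA bcoc_neq0
  bchC bch0 bchD bch_nondeg card_wgrp_neq0.

End KummerField.

Section CountableFractions.

Variables (n : nat).

Definition mpoly_code (p : {mpoly algC[n]}) : seq ('X_{1..n} * algC) :=
  [seq (u, p@_u) | u <- msupp p].

Definition mpoly_decode (s : seq ('X_{1..n} * algC)) : {mpoly algC[n]} :=
  \sum_(c <- s) c.2 *: 'X_[c.1].

Lemma mpoly_codeK : cancel mpoly_code mpoly_decode.
Proof. by move=> p; rewrite /mpoly_decode big_map -mpolyE. Qed.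

(** A fraction is coded by the monomials and coefficients of its numerator and denominator;
    countability gives access to an algebraic closure. *)
Lemma fraction_countable : {L : countClosedFieldType &
  {io : {rmorphism {fraction {mpoly algC[n]}} -> L} | integralRange io}}.
Proof.
pose code (x : {fraction {mpoly algC[n]}}) :=
  (mpoly_code (s2val (fracP x)).1, mpoly_code (s2val (fracP x)).2).
pose decode (c : seq ('X_{1..n} * algC) * seq ('X_{1..n} * algC)) :=
  (mpoly_decode c.1)%:F / (mpoly_decode c.2)%:F.
have codeK : cancel code decode.
  by move=> x; rewrite /decode /= !mpoly_codeK; case: fracP.
pose K : countFieldType := HB.pack {fraction {mpoly algC[n]}} (CanIsCountable codeK).
exact: (countable_algebraic_closure K).
Qed.

End CountableFractions.

(** * Rational functions with coefficients extended from k to K *)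

Section CoefficientExtension.

Variables (k K : fieldType) (iota : {rmorphism k -> K}) (n : nat).

Local Notation E := {fraction {mpoly K[n]}}.

Definition ecst (c : K) : E := (c%:MP : {mpoly K[n]})%:F.

HB.instance Definition _ :=
  GRing.RMorphism.copy ecst ((@tofrac {mpoly K[n]}) \o (@mpolyC n K)).

Lemma map_mpoly_inj (R S : fieldType) (f : {rmorphism R -> S}) :
  injective (map_mpoly f : {mpoly R[n]} -> {mpoly S[n]}).
Proof.
move=> p q pq; apply/mpolyP => u; apply: (fmorph_inj f).
by rewrite -!mcoeff_map_mpoly pq.
Qed.

Fact tofrac_map_inj (R S : fieldType) (f : {rmorphism R -> S}) :
  injective ((@tofrac {mpoly S[n]}) \o (map_mpoly f : {mpoly R[n]} -> _)).
Proof.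
by apply: inj_comp (@map_mpoly_inj _ _ f) => p q /eqP; rewrite tofrac_eq => /eqP.
Qed.

Definition emb : {rmorphism ratfun k n -> E} :=
  frac_rmorph (R := coord (affine_space k n))
    (h := (@tofrac {mpoly K[n]}) \o map_mpoly iota) (@tofrac_map_inj _ _ iota).

Lemma embE (p : {mpoly k[n]}) : emb (torat p) = (map_mpoly iota p)%:F.
Proof. exact: frac_rmorphE. Qed.

Lemma emb_alg (c : k) : emb c%:A = ecst (iota c).
Proof.
rewrite -(rmorph_alg (@torat k n)) embE; congr (_ %:F).
by rewrite alg_mpolyC map_mpolyC.
Qed.

Definition eext (s : {rmorphism K -> K}) : {rmorphism E -> E} :=
  frac_rmorph (h := (@tofrac {mpoly K[n]}) \o map_mpoly s) (@tofrac_map_inj _ _ s).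

Lemma eextE s (p : {mpoly K[n]}) : eext s p%:F = (map_mpoly s p)%:F.
Proof. exact: frac_rmorphE. Qed.

Lemma eext_cst s c : eext s (ecst c) = ecst (s c).
Proof. by rewrite eextE map_mpolyC. Qed.

Lemma eext_emb (s : {rmorphism K -> K}) x :
  (forall c, s (iota c) = iota c) -> eext s (emb x) = emb x.
Proof.
move=> si; have fix_torat (p : {mpoly k[n]}) : eext s (emb (torat p)) = emb (torat p).
  rewrite embE eextE; congr (_ %:F); apply/mpolyP => u.
  by rewrite !mcoeff_map_mpoly /= si.
exact: (frac_rmorph_ext (R := coord (affine_space k n)) (g := eext s \o emb) fix_torat).
Qed.

Lemma eext_comp (r s t : {rmorphism K -> K}) x :
  (forall c, r c = s (t c)) -> eext r x = eext s (eext t x).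
Proof.
move=> rst; apply: (frac_rmorph_ext (g' := eext s \o eext t)) => p /=; rewrite !eextE.
by congr (_ %:F); apply/mpolyP => u; rewrite !mcoeff_map_mpoly /= rst.
Qed.

Lemma eext_id (s : {rmorphism K -> K}) x : (forall c, s c = c) -> eext s x = x.
Proof.
move=> s1; apply: (frac_rmorph_ext (g' := idfun)) => p /=; rewrite eextE.
by congr (_ %:F); apply/mpolyP => u; rewrite mcoeff_map_mpoly /= s1.
Qed.

Lemma lc_eext (s : {rmorphism K -> K}) x : lc (eext s x) = s (lc x).
Proof.
case: (fracP x) => -[p q] /= q0 ->.
have sq0 : map_mpoly s q != 0.
  by rewrite -(rmorph0 (map_mpoly s)) (inj_eq (@map_mpoly_inj _ _ _)).
rewrite fmorph_div !eextE !lc_div // fmorph_div.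
have tw r : mleadc (map_mpoly s r) = s (mleadc r).
  apply: (mleadc_twist (f := fun _ c => s c)) => [u|_ c].
    exact: mcoeff_map_mpoly.
  exact: fmorph_eq0.
by rewrite !tw.
Qed.

Lemma lc_ecst c : lc (ecst c) = c.
Proof. exact: lcC. Qed.

End CoefficientExtension.

Section KummerDetector.

Variables (m : nat) (z : algC) (hz : m.+1.-primitive_root z).

Local Notation D := (kummer_datum hz).
Local Notation k := (base hz).
Local Notation N := (gdim D).
Local Notation inc := (@fixfield_inc _ _ (gamK hz) : {rmorphism k -> kfun}).

Local Notation efun := {fraction {mpoly kfun[N]}}.
Local Notation kemb := (emb inc N).
Local Notation gamE g := (eext N (gamK hz g)).

Definition emon (a : wgrp m) : efun := ecst N (kmon a).

Lemma emon0 : emon 0 = 1.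
Proof. by rewrite /emon kmon0 rmorph1. Qed.

Lemma emonM a b : emon a * emon b = kemb (bcoc hz a b)%:A * emon (a + b).
Proof.
rewrite emb_alg /emon -[LHS](rmorphM (ecst N)) -[RHS](rmorphM (ecst N)).
by congr (ecst N _); exact: bcocE.
Qed.

Lemma gamE_mon g a : gamE g (emon a) = kemb (bch hz g a)%:A * emon a.
Proof.
rewrite emb_alg /emon eext_cst gamK_mon; exact: (rmorphM (ecst N)).
Qed.

Lemma gamE_emb g x : gamE g (kemb x) = kemb x.
Proof. by apply: eext_emb => c; exact: (fixfield_incP c g). Qed.

Lemma gamED g h x : gamE (g + h) x = gamE g (gamE h x).
Proof. by apply: eext_comp => c; exact: gamKD. Qed.

Lemma gamE0 x : gamE 0 x = x.
Proof. by apply: eext_id => c; exact: gamK0. Qed.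

(** The inner [lc] is taken in the variables of the generic point and commutes with G; the outer
    one, in s and t, changes by an n-th root of unity, which the power removes. *)
Definition detect (x : efun) : algC := lc (lc x) ^+ m.+1.

Lemma detectM : {morph detect : x y / x * y}.
Proof. by move=> x y; rewrite /detect (lcM x y) (lcM (lc x) (lc y)) exprMn. Qed.

Lemma detect_eq0 x : (detect x == 0) = (x == 0).
Proof. by rewrite /detect expf_eq0 !lc_eq0. Qed.

Lemma lc_gamK g x : lc (gamK hz g x) ^+ m.+1 = lc x ^+ m.+1.
Proof.
case: (fracP x) => -[p q] /= q0 ->.
have wq0 : wact z g q != 0.
  by rewrite -(rmorph0 (wact z g)) (inj_eq (@wact_inj _ _ hz g)).
rewrite fmorph_div !gamKE !lc_div //.
have tw r : mleadc (wact z g r) = wt z g (mlead r) * mleadc r.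
  apply: (mleadc_twist (f := fun u c => wt z g u * c)) => [u|u c].
    exact: wact_coef.
  by rewrite mulf_eq0 (negbTE (wt_neq0 hz g u)).
by rewrite !tw !expr_div_n !exprMn !(wt_exp hz) !mul1r.
Qed.

Lemma detect_gamE g x : detect (gamE g x) = detect x.
Proof. by rewrite /detect lc_eext lc_gamK. Qed.

Lemma detect_cst c : detect (kemb (bcst hz c)%:A) = c ^+ m.+1.
Proof. by rewrite /detect emb_alg lc_ecst; congr (_ ^+ _); exact: lcC. Qed.

Lemma tw_kummer_integral : GRing.integral_domain_axiom (tw D (gfun D)).
Proof.
exact: (@tw_gfun_integral k efun D kemb emon (fun g => gamE g)
  emon0 emonM gamE_mon gamE_emb).
Qed.

Lemma kummer_not_retract (p : nat) : prime p -> (p %| m.+1)%N ->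
  ~ p_retract_rational p (norm1_var D).
Proof.
move=> pp pm; have pm0 : (0 < p * m.+1)%N by rewrite muln_gt0 prime_gt0.
have [w hw] := C_prim_root_exists pm0.
apply: (@norm1_not_retract k efun algC D kemb emon (fun g => gamE g) detect emon0
  emonM gamE_mon gamE_emb gamED gamE0 detectM detect_eq0 detect_gamE
  (@base_char0 _ _ hz) p (bcst hz w)).
  (* The constant w has norm one: its order [p * m.+1] divides [m.+1 ^ 2]. *)
  rewrite card_wgrp; apply: val_inj; rewrite rmorphXn /=.
  rewrite -rmorphXn; apply/eqP; rewrite -(rmorph1 (@kcst)) (inj_eq kcst_inj).
  by rewrite -(prim_order_dvd hw) expnS expn1 dvdn_pmul2r.
move=> d pd; rewrite [X in X ^+ _]detect_cst -exprM -(prim_order_dvd hw).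
by rewrite mulnC dvdn_pmul2l.
Qed.

Lemma kummer_torus_split : exists (n : nat) (L : fieldType) (iota : {rmorphism k -> L}),
  separable_closure iota /\ split_over (norm1_group D) iota n.
Proof.
have [L [io ioP]] := fraction_countable 2.
pose iota : {rmorphism k -> L} := io \o @fixfield_inc _ _ (gamK hz).
exists #|[pred g : kidx D | g != 0]|, L, iota; split.
  exact: (fixfield_separable_closure (gamKD hz) (gamK0 hz) (@base_char0 _ _ hz) ioP).
have e1 : io (kmon (0 : wgrp m)) = 1 by rewrite kmon0 rmorph1.
have eM (a b : wgrp m) :
    io (kmon a) * io (kmon b) = iota (bcoc hz a b) * io (kmon (a + b)).
  by rewrite -[LHS](rmorphM io) -[RHS](rmorphM io); congr (io _); exact: bcocE.
exact: (@norm1_group_split k L D iota (fun a => io (kmon a)) e1 eM).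
Qed.

Definition kummer_torus : torus k := Torus kummer_torus_split.

End KummerDetector.

Local Open Scope fset_scope.

Theorem theorem1p3 (S : {fset nat}) (hS : forall p : nat, p \in S -> prime p) :
  exists (k : fieldType) (T : torus k),
    forall p : nat, prime p -> (p_retract_rational p T <-> p \notin S).
Proof.
(* For S empty this is 1, and the torus is trivial. *)
pose n := (\prod_(q <- enum_fset S) q)%N.
have n0 : (0 < n)%N.
  by rewrite /n big_seq; apply: prodn_cond_gt0 => q /hS/prime_gt0.
have pnE p : prime p -> (p %| n)%N = (p \in S).
  move=> pp; apply/idP/idP => [|pS]; last first.
    by rewrite /n (big_rem p) //= dvdn_mulr.
  rewrite /n big_seq; elim/big_ind: _ => [|x y IHx IHy|q qS].
  - by rewrite dvdn1 => /eqP p1; rewrite p1 in pp.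
  - by rewrite Euclid_dvdM // => /orP[/IHx|/IHy].
  - by rewrite dvdn_prime2 ?(hS q qS) // => /eqP ->; exact: qS.
have [z hz] := C_prim_root_exists n0; case: n => [//|m] in n0 pnE z hz *.
exists (base hz), (kummer_torus hz) => p pp; rewrite -pnE //; split.
  by move=> ret; apply/negP => pm; exact: (kummer_not_retract pp pm ret).
move=> pm; apply: (norm1_retract (@tw_kummer_integral _ _ hz)).
by rewrite card_wgrp Euclid_dvdX // (negbTE pm).
Qed.
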